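(* For every positive integer $t$, there exists a graph $G$ of girth $5$ such that $G$ does not contain $K_6^{(1)}$ (the $1$-subdivision of the complete graph $K_6$) as an induced minor, and there is no $K_t$-minor-free graph $H$ such that $G$ is a region intersection graph over $H$.
   Context: All graphs are finite and simple. The girth of a graph is the number of vertices of a shortest cycle. For a graph $F$, $F^{(1)}$ denotes the graph obtained from $F$ by replacing every edge by a path with two edges. A graph $H$ is a minor of $G$ if there is a collection $(X_v : v \in V(H))$ of pairwise disjoint vertex sets of $G$, each inducing a connected subgraph, such that $X_u$ and $X_v$ are joined by an edge of $G$ whenever $uv \in E(H)$; $G$ is $H$-minor-free if $H$ is not a minor of $G$. $H$ is an induced minor of $G$ if there is such a collection with the additional property that $X_u$ and $X_v$ are joined by an edge of $G$ if and only if $uv \in E(H)$. A graph $G$ is a region intersection graph over a graph $H$ if there is a collection $(R_v : v \in V(G))$ of connected subgraphs of $H$ such that for distinct $u,v\in V(G)$, $uv \in E(G)$ if and only if $V(R_u) \cap V(R_v) \neq \emptyset$. *)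

(* Defs.v *)
From HB Require Import structures.
From mathcomp Require Import all_boot.

Set Implicit Arguments.
Unset Strict Implicit.
Unset Printing Implicit Defensive.

Record sgraph := SGraph {
  vertex :> finType;
  adj : rel vertex;
  adj_sym : symmetric adj;
  adj_irrefl : irreflexive adj }.

Section Graphs.
Variable G : sgraph.

Definition edges : {set {set G}} :=
  [set A | [exists x, exists y, adj x y && (A == [set x; y])]].

(* [ucycle] says that consecutive vertices, including the last and the first,
   are adjacent and that all vertices are distinct; the size condition removes
   the degenerate cases of the empty sequence and of a single edge. *)
Definition is_cycle (c : seq G) : Prop := ucycle (@adj G) c /\ 3 <= size c.

Definition has_girth (g : nat) : Prop :=
  (exists2 c, is_cycle c & size c = g) /\
  (forall c, is_cycle c -> g <= size c).

(* A subgraph is not necessarily induced. *)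
Record subgraph := Subgraph {
  sub_vertices : {set G};
  sub_adj : rel G;
  sub_adj_sym : symmetric sub_adj;
  sub_adj_adj : subrel sub_adj (@adj G);
  sub_adj_vertices :
    forall x y, sub_adj x y -> (x \in sub_vertices) && (y \in sub_vertices) }.

(* Connected graphs are nonempty. *)
Definition connected (F : subgraph) : Prop :=
  sub_vertices F != set0 /\
  {in sub_vertices F &, forall x y, connect (sub_adj F) x y}.

Definition induced_adj (X : {set G}) : rel G :=
  fun x y => [&& x \in X, y \in X & adj x y].

Lemma induced_adj_sym X : symmetric (induced_adj X).
Proof. by move=> x y; rewrite /induced_adj adj_sym andbCA. Qed.

Lemma induced_adj_adj X : subrel (induced_adj X) (@adj G).
Proof. by move=> x y /and3P[]. Qed.

Lemma induced_adj_vertices (X : {set G}) x y :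
  induced_adj X x y -> (x \in X) && (y \in X).
Proof. by case/and3P=> -> ->. Qed.

Definition induced (X : {set G}) : subgraph :=
  Subgraph (@induced_adj_sym X) (@induced_adj_adj X) (@induced_adj_vertices X).

Definition joined (X Y : {set G}) : Prop :=
  exists x y, [/\ x \in X, y \in Y & adj x y].

End Graphs.

Lemma complete_adj_sym t : symmetric (fun x y : 'I_t => x != y).
Proof. by move=> x y; rewrite eq_sym. Qed.

Lemma complete_adj_irrefl t : irreflexive (fun x y : 'I_t => x != y).
Proof. by move=> x; rewrite eqxx. Qed.

Definition complete (t : nat) : sgraph :=
  SGraph (@complete_adj_sym t) (@complete_adj_irrefl t).

Section Subdivision.
Variable F : sgraph.

(* The vertices of the 1-subdivision are the vertices of F together with one
   vertex for each edge of F, adjacent to the two ends of that edge. *)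
Definition subdiv_vertex : finType := (F + {A : {set F} | A \in edges F})%type.

Definition subdiv_adj : rel subdiv_vertex := fun a b =>
  match a, b with
  | inl v, inr A => v \in val A
  | inr A, inl v => v \in val A
  | _, _ => false
  end.

Lemma subdiv_adj_sym : symmetric subdiv_adj.
Proof. by case=> a [] b. Qed.

Lemma subdiv_adj_irrefl : irreflexive subdiv_adj.
Proof. by case. Qed.

Definition subdiv : sgraph := SGraph subdiv_adj_sym subdiv_adj_irrefl.

End Subdivision.

Definition minor (H G : sgraph) : Prop :=
  exists X : H -> {set G},
  [/\ forall v, connected (induced (X v)),
      forall u v, u != v -> [disjoint X u & X v]
    & forall u v, adj u v -> joined (X u) (X v)].

(* The equivalence is for distinct vertices only, since the two ends of an edge
   of G may lie in the same set X u. *)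
Definition induced_minor (H G : sgraph) : Prop :=
  exists X : H -> {set G},
  [/\ forall v, connected (induced (X v)),
      forall u v, u != v -> [disjoint X u & X v]
    & forall u v, u != v -> (joined (X u) (X v) <-> adj u v)].

Definition minor_free (H G : sgraph) : Prop := ~ minor H G.

Definition region_intersection_graph (G H : sgraph) : Prop :=
  exists R : G -> subgraph H,
    (forall v, connected (R v)) /\
    (forall u v, u != v ->
       (adj u v <-> sub_vertices (R u) :&: sub_vertices (R v) != set0)).

(* Main.v *)
Require Import Defs.
From Stdlib Require Import Ring.
From mathcomp Require Import all_boot zify.

Set Implicit Arguments.
Unset Strict Implicit.
Unset Printing Implicit Defensive.

(** The graph is a planar grid with three bundles of vertical paths: many on
    the far left, the two columns L and R in the middle, many on the far right;
    all horizontal rows run through. For every label a, a new vertex v_a is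
    joined to the (a+1)-st vertex after the left bundle and to the (a+1)-st one
    after R in every row and, in every P-th row only, to the a-th vertex before
    R. These P-th rows are called special.

    Without the vertices v_a the graph is planar, so it has no K_6^(1) as an
    induced minor. If v_a lies in a bag of a model of K_6^(1), then after the
    deletion of one branch vertex of K_6 at most one bag meets the neighbours of
    v_a; cutting the grid along these neighbours and rearranging the three parts
    gives a planar drawing of K_5. Planarity is used through van Kampen's parity
    count of the crossings of independent edges.

    Suppose that the graph is a region intersection graph over H. The region of
    v_a is connected and meets the disjoint regions of its neighbours, so from
    the neighbour in the s-th special row a connected piece of it leads to that
    in another row, avoiding all other neighbours. By pigeonhole this row does
    not depend on a for many labels a. These links, taken in different regions
    and hence disjoint, let the paths of the planar grid cross: either many
    special rows are linked to one row, or many links jump over the column L or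
    R, or many links join rows far from each other. In each case K_t is a minor
    of H, obtained from bundles of vertical paths that drift by at most one
    column per row. *)

(** * Connected sets and minors *)

(** Girth 5 comes from keeping the rows two levels apart: the odd levels carry only subdivision
    vertices of the vertical paths, whose columns are never consecutive. Between L and R the labels
    run from right to left. Cutting along [v_a] puts the labels above [a] on lines left of L and the
    labels below [a] on lines right of R. As the labels decrease from L to R, the part of a special
    row between L and [v_a] leaves L on its left side, the other part leaves R on its right side,
    and nothing crosses. The other rows run from L to R undisturbed. Two links inside one region may
    intersect, so each of the t^2 crossings needed for K_t gets a label of its own, and all these
    labels must send the special rows to the same rows. Hence the number m of labels has to exceed a
    multiple of the number of maps from special rows to rows. It is chosen last, after the room D
    for the drift of the paths, the distance P and the number N of the special rows, and the height
    h. *)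

Section Econ.
Variables (I : finType) (E : rel I).
Implicit Types D : {set I}.

Definition restr D : rel I := fun x y => [&& x \in D, y \in D & E x y].

Definition econ D : Prop :=
  D != set0 /\ {in D &, forall x y, connect (restr D) x y}.

Definition linked D D' : Prop :=
  exists x y, [/\ x \in D, y \in D' & (x == y) || E x y].

Lemma restr_sub D D' x y :
  D \subset D' -> connect (restr D) x y -> connect (restr D') x y.
Proof.
move=> /subsetP sD; apply: connect_sub => a b /and3P[aD bD ab].
by apply: connect1; rewrite /restr !sD.
Qed.

Lemma econ1 x : econ [set x].
Proof.
split; first by apply/set0Pn; exists x; rewrite inE.
by move=> a b /set1P-> /set1P->.
Qed.

(** The sets [F j] need to be connected only together with the core [D]; a trimmed connector may
    even be empty. *)
Lemma econ_star (J : finType) (Q : pred J) D (F : J -> {set I}) :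
  econ D -> (forall j, Q j -> econ (D :|: F j)) ->
  econ (D :|: \bigcup_(j | Q j) F j).
Proof.
move=> [D0 cD] cF; have /set0Pn[d dD] := D0.
set U := (X in econ X).
have sU j : Q j -> D :|: F j \subset U.
  by move=> Qj; rewrite setUS //; apply: bigcup_sup.
have cd x : x \in U -> connect (restr U) x d /\ connect (restr U) d x.
  rewrite inE => /orP[xD|/bigcupP[j Qj xF]].
    by split; apply: restr_sub (subsetUl _ _) _; apply: cD.
  have [_ cj] := cF j Qj.
  by split; apply: restr_sub (sU j Qj) _; apply: cj; rewrite !inE ?dD ?xF ?orbT.
split; first by apply/set0Pn; exists d; rewrite inE dD.
by move=> x y /cd[xd _] /cd[_ dy]; apply: connect_trans xd dy.
Qed.

Hypothesis symE : symmetric E.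

Lemma linkedC D D' : linked D D' -> linked D' D.
Proof. by move=> [x [y [xD yD h]]]; exists y, x; split=> //; rewrite eq_sym symE. Qed.

Lemma linkedW D1 D2 D1' D2' : D1 \subset D1' -> D2 \subset D2' ->
  linked D1 D2 -> linked D1' D2'.
Proof.
by move=> /subsetP s1 /subsetP s2 [x [y [xD yD h]]]; exists x, y; split; auto.
Qed.

(** Transports connectedness from an index graph to the union of the sets assigned to its vertices,
    both into [H] and into the plane drawing. *)
Lemma econ_bigcup (J : finType) (EJ : rel J) (DJ : {set J}) (F : J -> {set I}) :
  DJ != set0 ->
  {in DJ &, forall i j,
     connect (fun x y => [&& x \in DJ, y \in DJ & EJ x y]) i j} ->
  (forall i, i \in DJ -> econ (F i)) ->
  (forall i j, i \in DJ -> j \in DJ -> EJ i j -> linked (F i) (F j)) ->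
  econ (\bigcup_(i in DJ) F i).
Proof.
move=> /set0Pn[i0 i0D] cJ cF lF.
set U := \bigcup_(i in DJ) F i.
have sU i : i \in DJ -> F i \subset U by move=> iD; apply: bigcup_sup.
split.
  have [/set0Pn[x xF] _] := cF i0 i0D.
  by apply/set0Pn; exists x; apply: (subsetP (sU i0 i0D)).
move=> x y /bigcupP[i iD xF] /bigcupP[j jD yF].
have /connectP[p] := cJ i j iD jD.
elim: p i iD x xF => [|k p IH] i iD x xF /=.
  move=> _ ji; rewrite ji in yF.
  by have [_ ci] := cF i iD; apply: restr_sub (sU i iD) _; apply: ci.
move=> /andP[/and3P[_ kD ik]] pp jl.
have [a [b [aF bF ab]]] := lF i k iD kD ik.
have [_ ci] := cF i iD.
apply: connect_trans (restr_sub (sU i iD) (ci x a xF aF)) _.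
apply: connect_trans (IH k kD b bF pp jl).
case/orP: ab => [/eqP->|ab]; first exact: connect0.
apply: connect1; rewrite /restr ab (subsetP (sU i iD)) //.
by rewrite (subsetP (sU k kD)).
Qed.

Lemma econU D D' : econ D -> econ D' -> linked D D' -> econ (D :|: D').
Proof.
move=> cD cD' lD.
have -> : D :|: D' = \bigcup_(b in [set: bool]) (if b then D else D').
  apply/setP=> x; rewrite inE; apply/orP/bigcupP.
    by case=> h; [exists true | exists false]; rewrite ?inE.
  by case=> -[] _ h; [left | right].
apply: (@econ_bigcup _ (fun _ _ => true)).
- by apply/set0Pn; exists true; rewrite inE.
- by move=> a b _ _; apply: connect1; rewrite !inE.
- by case.
have lxx X : econ X -> linked X X.
  by move=> [/set0Pn[x xX] _]; exists x, x; rewrite eqxx.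
by case=> -[] _ _ _; [apply: lxx | | apply: linkedC | apply: lxx].
Qed.

Lemma econ_add D x : econ D -> linked D [set x] -> econ (x |: D).
Proof. by move=> cD l; rewrite setUC; apply: econU => //; apply: econ1. Qed.

End Econ.

Section Assemble.
Variable H : sgraph.
Implicit Types M S T : {set H}.
Local Notation con := (@econ H (@adj H)).
Local Notation lnk := (@linked H (@adj H)).

Lemma linked_joined M S : lnk M S -> [disjoint M & S] -> joined M S.
Proof.
move=> [x [y [xM yS /orP[/eqP xy|xy]]]] d; last by exists x, y.
by move: (disjointFr d xM); rewrite xy yS.
Qed.

(* A connector is followed from M up to its first vertex in M'. *)
Lemma trim_connector M M' S :
  con M -> con S -> lnk M S -> lnk S M' -> [disjoint M & M'] ->
  exists T, [/\ T \subset S, [disjoint T & M'], con (M :|: T)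
              & joined (M :|: T) M'].
Proof.
move=> cM [_ cS] [x [y [xM yS xy]]] [y' [x' [y'S x'M lx']]] dM.
have /connectP[p] := cS y y' yS y'S.
elim: p M cM x xM y yS xy dM => [|z p IH] M cM x xM y yS xy dM /=.
  move=> _ yy'; rewrite yy' in lx' y'S.
  have lM : lnk M [set y] by exists x, y; rewrite inE eqxx.
  (* If [y] already lies in [M'], disjointness of [M] and [M'] turns the link into an edge, and
     nothing has to be added. *)
  have [yM'|yM'] := boolP (y \in M').
    exists set0; rewrite setU0; split=> //; first exact: sub0set.
      by rewrite -setI_eq0 set0I.
    by apply: linked_joined => //; exists x, y.
  have d1 : [disjoint [set y] & M'] by rewrite disjoints1.
  exists [set y]; split=> //; first by rewrite sub1set.
    by rewrite setUC; apply: econ_add => //; apply: adj_sym.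
  apply: linked_joined; first by exists y, x'; rewrite !inE eqxx orbT.
  by rewrite -setI_eq0 setIUl setU_eq0 !setI_eq0 dM.
move=> /andP[/and3P[_ zS yz] pp] y'l.
have lM : lnk M [set y] by exists x, y; rewrite inE eqxx.
have [yM'|yM'] := boolP (y \in M').
  exists set0; rewrite setU0; split=> //; first exact: sub0set.
    by rewrite -setI_eq0 set0I.
  by apply: linked_joined => //; exists x, y.
have d1 : [disjoint [set y] & M'] by rewrite disjoints1.
have [||||T [sT dT cT jT]] := IH (y |: M) _ y _ z zS _ _ pp y'l.
- by apply: econ_add => //; apply: adj_sym.
- by rewrite !inE eqxx.
- by rewrite yz orbT.
- by rewrite -setI_eq0 setIUl setU_eq0 !setI_eq0 dM d1.
exists (y |: T); split.
- by rewrite subUset sub1set yS.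
- by rewrite -setI_eq0 setIUl setU_eq0 !setI_eq0 d1.
- by rewrite setUCA setUA.
- by rewrite setUCA setUA.
Qed.

(** Each connector is trimmed and absorbed by the bag of its smaller index. Therefore connectors
    with the same first index may intersect, and a connector may meet the two bags that it joins. *)
Lemma minor_complete_connectors t (M : 'I_t -> {set H})
    (S : 'I_t -> 'I_t -> {set H}) :
  (forall i, con (M i)) ->
  (forall i j, i != j -> [disjoint M i & M j]) ->
  (forall i j : 'I_t, i < j -> con (S i j)) ->
  (forall i j : 'I_t, i < j -> lnk (M i) (S i j)) ->
  (forall i j : 'I_t, i < j -> lnk (S i j) (M j)) ->
  (forall i j k : 'I_t, i < j -> k != i -> k != j -> [disjoint S i j & M k]) ->
  (forall i j k l : 'I_t, i < j -> k < l -> i != k ->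
     [disjoint S i j & S k l]) ->
  minor (complete t) H.
Proof.
move=> cM dM cS lM lS dS dSS.
have /fin_all_exists[T TP] : forall ij : 'I_t * 'I_t, exists T, ij.1 < ij.2 ->
    [/\ T \subset S ij.1 ij.2, [disjoint T & M ij.2], con (M ij.1 :|: T)
              & joined (M ij.1 :|: T) (M ij.2)].
  move=> [i j] /=; case: (ltnP i j) => ij; last by exists set0.
  have := trim_connector (cM i) (cS _ _ ij) (lM _ _ ij) (lS _ _ ij).
  by case=> [|T hT]; [apply: dM; rewrite -val_eqE /=; lia | exists T].
pose X (i : 'I_t) := M i :|: \bigcup_(j : 'I_t | i < j) T (i, j).
have sTM (i j k : 'I_t) : i < j -> k != i -> [disjoint T (i, j) & M k].
  move=> ij ki; have [/= sT dT _ _] := TP (i, j) ij.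
  have [->//|kj] := eqVneq k j.
  by apply: disjointWl sT _; apply: dS.
have XP (i j : 'I_t) z : i != j -> z \in X i -> z \in X j -> false.
  move=> ij; rewrite !inE => /orP[zi|/bigcupP[k ik zi]] /orP[zj|/bigcupP[l jl zj]].
  - by rewrite (disjointFr (dM i j ij) zi) in zj.
  - by rewrite (disjointFr (sTM j l i jl ij) zj) in zi.
  - by rewrite eq_sym in ij; rewrite (disjointFr (sTM i k j ik ij) zi) in zj.
  have [/= /subsetP s1 _ _ _] := TP (i, k) ik.
  have [/= /subsetP s2 _ _ _] := TP (j, l) jl.
  by move: (s2 z zj); rewrite (disjointFr (dSS i k j l ik jl ij) (s1 z zi)).
exists X; split.
- move=> i; apply: econ_star => // j ij.
  by have [] := TP (i, j) ij.
- move=> i j ij; apply/pred0P=> z /=; apply/negP=> /andP[zi zj].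
  by have := XP i j z ij zi zj.
have main (i j : 'I_t) : i < j -> joined (X i) (X j).
  move=> ij; have [/= _ _ _ [x [y [xi yj xy]]]] := TP (i, j) ij.
  exists x, y; split=> //; last by rewrite inE yj.
  move: xi; rewrite !inE => /orP[->//|xT]; apply/orP; right.
  by apply/bigcupP; exists j.
move=> u v /= uv; case: (ltngtP u v) => h; last by rewrite (val_inj h) eqxx in uv.
  exact: main.
have [x [y [xu yv xy]]] := main v u h.
by exists y, x; split=> //; rewrite adj_sym.
Qed.

Variables (I : finType) (E E2 : rel I) (F : I -> {set H}).
Hypotheses (cF : forall x, con (F x))
  (lF : forall x y, E x y -> lnk (F x) (F y))
  (dF : forall x y, x != y -> ~~ E2 x y -> [disjoint F x & F y]).

(** [E] guarantees links and [E2] lists the pairs whose images may meet. The two relations differ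
    because links taken inside one region can intersect without being joined on purpose. *)
Definition anti (A B : {set I}) :=
  forall x y, x \in A -> y \in B -> (x != y) && ~~ E2 x y.

Lemma con_cover (A : {set I}) : econ E A -> con (\bigcup_(x in A) F x).
Proof.
move=> [A0 cA]; apply: (@econ_bigcup _ _ _ E) => //.
by move=> i j _ _; apply: lF.
Qed.

Lemma anti_disjoint (A B : {set I}) : anti A B ->
  [disjoint \bigcup_(x in A) F x & \bigcup_(x in B) F x].
Proof.
move=> aAB; apply/pred0P=> z /=; apply/negP=> /andP[/bigcupP[x xA zx]].
move=> /bigcupP[y yB zy]; have /andP[xy nE] := aAB x y xA yB.
by have := disjointFr (dF xy nE) zx; rewrite zy.
Qed.

Lemma minor_complete_regions t (M : 'I_t -> {set I}) (g : 'I_t -> 'I_t -> I) :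
  (forall i, econ E (M i)) ->
  (forall i j, i != j -> anti (M i) (M j)) ->
  (forall i j : 'I_t, i < j -> exists2 x, x \in M i & E x (g i j)) ->
  (forall i j : 'I_t, i < j -> exists2 x, x \in M j & E (g i j) x) ->
  (forall i j k : 'I_t, i < j -> k != i -> k != j -> anti [set g i j] (M k)) ->
  (forall i j k l : 'I_t, i < j -> k < l -> i != k -> anti [set g i j] [set g k l]) ->
  minor (complete t) H.
Proof.
move=> cM aM l1 l2 ag agg.
apply: (@minor_complete_connectors t (fun i => \bigcup_(x in M i) F x)
          (fun i j => \bigcup_(x in [set g i j]) F x)).
- by move=> i; apply: con_cover.
- by move=> i j ij; apply/anti_disjoint/aM.
- by move=> i j ij; apply/con_cover/econ1.
- move=> i j ij; have [x xM xg] := l1 i j ij.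
  apply: linkedW (lF xg); last by rewrite big_set1.
  exact: bigcup_sup.
- move=> i j ij; have [x xM xg] := l2 i j ij.
  apply: linkedW (lF xg); first by rewrite big_set1.
  exact: bigcup_sup.
- by move=> i j k ij ki kj; apply/anti_disjoint/ag.
- by move=> i j k l ij kl ik; apply/anti_disjoint/agg.
Qed.

End Assemble.

(** * Planarity of the grid *)

(** In terms of [xorb] the parity identities below are equations in a Boolean ring, which [ring]
    decides. *)
Lemma xorbE x y : x (+) y = xorb x y.
Proof. by case: x; case: y. Qed.

Lemma addb_comb A B A1 B1 A2 B2 : A1 = B1 -> A2 = B2 ->
  xorb A B = xorb (xorb A1 B1) (xorb A2 B2) -> A = B.
Proof. by move=> -> ->; case: A; case: B; case: B1; case: B2. Qed.

Section VanKampen.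
Variables (V : finType) (E lt : rel V) (u : V -> V -> V -> bool).
Hypothesis lt_asym : forall a b, a != b -> lt a b = ~~ lt b a.

(* Think of [u a b c] as "the edge ab meets the vertical ray above c": two
   disjoint segments are met by the rays of each other's end points an odd
   number of times precisely when their end points interleave. *)
Hypothesis uE : forall a a' b b', E a a' -> E b b' ->
  a != b -> a != b' -> a' != b -> a' != b' ->
  u a a' b (+) u a a' b' (+) (u b b' a (+) u b b' a') =
  lt a b (+) lt a' b (+) (lt a b' (+) lt a' b').

Fixpoint ray x p c := if p is y :: p' then u x y c (+) ray y p' c else false.

(** Summing [uE] over all pairs of an edge of one path and an edge of the other makes every term at
    an inner vertex occur twice; only the four ends survive. *)
Lemma ray_interleave x p y q : path E x p -> path E y q ->
  (forall a b, a \in x :: p -> b \in y :: q -> a != b) ->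
  ray x p y (+) ray x p (last y q) (+) (ray y q x (+) ray y q (last x p)) =
  lt x y (+) lt (last x p) y (+) (lt x (last y q) (+) lt (last x p) (last y q)).
Proof.
have edge a a' z r : E a a' -> path E z r ->
    (forall b, b \in z :: r -> (a != b) && (a' != b)) ->
    u a a' z (+) u a a' (last z r) (+) (ray z r a (+) ray z r a') =
    lt a z (+) lt a' z (+) (lt a (last z r) (+) lt a' (last z r)).
  move=> aa'; elim: r z => [|w r IH] z /=; first by move=> _ _; rewrite !addbb.
  move=> /andP[zw wr] d.
  have dw : forall b, b \in w :: r -> (a != b) && (a' != b).
    by move=> b bw; apply: d; rewrite inE bw orbT.
  have h2 := IH w wr dw.
  have /andP[d1 d2] := d z (mem_head _ _).
  have /andP[d3 d4] := dw w (mem_head _ _).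
  apply: addb_comb (uE aa' zw d1 d3 d2 d4) h2 _.
  by rewrite !xorbE; ring.
elim: p x => [|z p IH] x /=; first by move=> _ _ _; rewrite !addbb.
move=> /andP[xz zp] yq d.
have dz : forall a b, a \in z :: p -> b \in y :: q -> a != b.
  by move=> a b az bq; apply: d => //; rewrite inE az orbT.
have h2 := IH z zp yq dz.
have : forall b, b \in y :: q -> (x != b) && (z != b).
  by move=> b bq; rewrite d ?dz ?mem_head.
move=> /(edge _ _ _ _ xz yq) h1.
by apply: addb_comb h1 h2 _; rewrite !xorbE; ring.
Qed.

Lemma no_K5 (c : 'I_5 -> V) (A : 'I_5 -> 'I_5 -> {set V}) :
  (forall i j, i != j -> c i != c j) ->
  (forall i j : 'I_5, i < j ->
     [/\ c i \in A i j, c j \in A i j & econ E (A i j)]) ->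
  (forall i j k l : 'I_5, i < j -> k < l ->
     i != k -> i != l -> j != k -> j != l -> [disjoint A i j & A k l]) ->
  False.
Proof.
move=> cI hA dA.
have /fin_all_exists[w wP] : forall ij : 'I_5 * 'I_5, exists p, ij.1 < ij.2 ->
    [/\ path E (c ij.1) p, last (c ij.1) p = c ij.2
      & {subset c ij.1 :: p <= A ij.1 ij.2}].
  move=> [i j] /=; case: (ltnP i j) => ij; last by exists [::].
  have [ci cj [_ cA]] := hA i j ij.
  have /connectP[p pp pl] := cA _ _ ci cj.
  exists p => _; split=> //.
    by apply: sub_path pp => x y /and3P[].
  have : all (mem (A i j)) (c i :: p).
    rewrite /= ci /=; elim: p (c i) pp {pl} => //= z p IH x.
    by move=> /andP[/and3P[_ -> _] /IH].
  by move/allP.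
pose r i j k := ray (c i) (w (i, j)) (c k).
have key (i j k l : 'I_5) : i < j -> k < l ->
    [&& i != k, i != l, j != k & j != l] ->
    r i j k (+) r i j l (+) (r k l i (+) r k l j) =
    lt (c i) (c k) (+) lt (c j) (c k) (+) (lt (c i) (c l) (+) lt (c j) (c l)).
  move=> ij kl /and4P[h1 h2 h3 h4].
  have [/= p1 l1 s1] := wP (i, j) ij; have [/= p2 l2 s2] := wP (k, l) kl.
  have := ray_interleave p1 p2; rewrite l1 l2; apply=> a b /s1 aA /s2 bA.
  apply: contraTneq aA => ->; rewrite (disjointFl _ bA) //.
  exact: dA.
pose o n : 'I_5 := inord n.
have oE n : n < 5 -> (o n : nat) = n by move=> h; rewrite inordK.
pose s i k := lt (c (o i)) (c (o k)).
pose q i j k := r (o i) (o j) (o k).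
pose Z i j k l := xorb (xorb (xorb (q i j k) (q i j l)) (xorb (q k l i) (q k l j)))
  (xorb (xorb (s i k) (s j k)) (xorb (s i l) (s j l))).
have K i j k l : i < j < 5 -> k < l < 5 -> [&& i != k, i != l, j != k & j != l] ->
    Z i j k l = false.
  move=> h1 h2 h3; rewrite /Z -!xorbE /q key ?addbb // -?val_eqE /= ?oE; lia.
have D k i : i < k < 5 -> s k i = xorb true (s i k).
  move=> h; rewrite -xorbE addTb; apply/lt_asym/cI; rewrite -val_eqE /= !oE; lia.
(* These are the fifteen pairs of disjoint edges of K_5. Every ray term occurs in exactly two of
   them and cancels. Of the order terms, three per four-element set of indices appear with swapped
   arguments, so asymmetry contributes fifteen ones, an odd number. *)
have : xorb (Z 1 4 2 3) (xorb (Z 1 3 2 4) (xorb (Z 1 2 3 4) (xorb (Z 0 4 2 3) (xorb (Z 0 3 2 4) (xorb (Z 0 2 3 4) (xorb (Z 0 4 1 3) (xorb (Z 0 3 1 4) (xorb (Z 0 1 3 4) (xorb (Z 0 4 1 2) (xorb (Z 0 2 1 4) (xorb (Z 0 1 2 4) (xorb (Z 0 3 1 2) (xorb (Z 0 2 1 3) (xorb (Z 0 1 2 3) (false))))))))))))))) = true.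
  rewrite /Z (D 2 1) ?(D 3 1) ?(D 3 2) ?(D 4 1) ?(D 4 2) ?(D 4 3) //.
  clearbody s q; clear; ring.
by rewrite !K.
Qed.

End VanKampen.

Section Grid.
Variables a b : nat.
Local Notation V := ('I_a * 'I_b)%type.

Definition grid_adj : rel V := fun p q =>
  ((p.1 == q.1 :> nat) && ((p.2.+1 == q.2) || (q.2.+1 == p.2))) ||
  ((p.2 == q.2 :> nat) && ((p.1.+1 == q.1) || (q.1.+1 == p.1))).

Lemma grid_adj_sym : symmetric grid_adj.
Proof. by move=> p q; rewrite /grid_adj; lia. Qed.

Definition grid_lt : rel V := fun p q => (p.1 < q.1) || (p.1 == q.1 :> nat) && (p.2 < q.2).

(** Imagine the grid slightly sheared, higher points moving to the right. The vertical ray above [c]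
    then passes just left of the points above [c], so it meets exactly the horizontal edges whose
    right end is such a point; [grid_lt] is the order of the sheared abscissas. *)
Definition grid_ray (p q c : V) : bool :=
  [&& p.2 == q.2 :> nat, c.2 < p.2 & maxn p.1 q.1 == c.1].

Lemma no_K5_grid (c : 'I_5 -> V) (A : 'I_5 -> 'I_5 -> {set V}) :
  (forall i j, i != j -> c i != c j) ->
  (forall i j : 'I_5, i < j ->
     [/\ c i \in A i j, c j \in A i j & econ grid_adj (A i j)]) ->
  (forall i j k l : 'I_5, i < j -> k < l ->
     i != k -> i != l -> j != k -> j != l -> [disjoint A i j & A k l]) ->
  False.
Proof.
apply: (@no_K5 _ grid_adj grid_lt grid_ray).
  by move=> [p q] [p' q']; rewrite xpair_eqE -!val_eqE /grid_lt /=; lia.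
move=> [x1 y1] [x2 y2] [x3 y3] [x4 y4]; rewrite !xpair_eqE -!val_eqE /=.
rewrite /grid_adj /grid_lt /grid_ray /=.
move: (x1 : nat) (y1 : nat) (x2 : nat) (y2 : nat) => {}x1 {}y1 {}x2 {}y2.
move: (x3 : nat) (y3 : nat) (x4 : nat) (y4 : nat) => {}x3 {}y3 {}x4 {}y4.
have split x y x' y' : (x == x') && ((y.+1 == y') || (y'.+1 == y)) ||
    (y == y') && ((x.+1 == x') || (x'.+1 == x)) ->
    [\/ x = x' /\ y.+1 = y', x = x' /\ y'.+1 = y, y = y' /\ x.+1 = x' 
      | y = y' /\ x'.+1 = x].
  case/orP=> /andP[/eqP-> /orP[]/eqP->].
  - by constructor 1.
  - by constructor 2.
  - by constructor 3.
  - by constructor 4.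
move=> /split[][<- <-] /split[][<- <-]; move=> {split} n1 n2 n3 n4;
rewrite ?eqxx ?(gtn_eqF (ltnSn _)) ?(ltn_eqF (ltnSn _)) /= ?andbF ?addbF ?addFb;
rewrite ?(maxn_idPl (leqnSn _)) ?(maxn_idPr (leqnSn _)) ?maxnn.
all: repeat match goal with
  | |- context [?a < ?b] => case: (ltnP a b) => ?; try (exfalso; lia)
  | |- context [?a == ?b] => case: (eqVneq a b) => ?; try (exfalso; lia) end.
all: try by [].
Qed.

End Grid.

(** * The graph and its girth *)

Definition step a b c d :=
  (a == c) && ((b.+1 == d) || (d.+1 == b)) || (b == d) && ((a.+1 == c) || (c.+1 == a)).

Lemma common_step x1 x2 y1 y2 u1 u2 : step x1 x2 u1 u2 -> step y1 y2 u1 u2 ->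
  x1 <> y1 \/ x2 <> y2 ->
  (x1 = y1 /\ u1 = x1 /\ u2 + u2 = x2 + y2) \/ (x2 = y2 /\ u2 = x2 /\ u1 + u1 = x1 + y1)
  \/ ((x1.+1 = y1 \/ y1.+1 = x1) /\ (x2.+1 = y2 \/ y2.+1 = x2) /\
      (u1 = x1 /\ u2 = y2 \/ u1 = y1 /\ u2 = x2)).
Proof.
have split i j k l : step i j k l -> (i = k /\ j.+1 = l) \/ (i = k /\ l.+1 = j) \/
  (j = l /\ i.+1 = k) \/ (j = l /\ k.+1 = i) by rewrite /step; lia.
by move=> /split h1 /split h2 xy; lia.
Qed.

Lemma unit_square x1 x2 y1 y2 u1 u2 v1 v2 : step x1 x2 u1 u2 -> step y1 y2 u1 u2 ->
  step x1 x2 v1 v2 -> step y1 y2 v1 v2 -> x1 <> y1 \/ x2 <> y2 ->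
  u1 <> v1 \/ u2 <> v2 ->
  [/\ x1.+1 = y1 \/ y1.+1 = x1, x2.+1 = y2 \/ y2.+1 = x2 &
    [/\ u1 = x1, u2 = y2, v1 = y1 & v2 = x2] \/ [/\ u1 = y1, u2 = x2, v1 = x1 & v2 = y2]].
Proof.
move=> h1 h2 h3 h4 xy uv.
have := common_step h1 h2 xy; have := common_step h3 h4 xy; clear h1 h2 h3 h4.
case=> [[a1 [a2 a3]]|[[a1 [a2 a3]]|[a1 [a2 a3]]]];
case=> [[b1 [b2 b3]]|[[b1 [b2 b3]]|[b1 [b2 b3]]]]; try (exfalso; lia).
by split=> //; case: a3 b3 => -[a3 a4] [] [b3 b4]; first [lia | by right | by left].
Qed.

Section Construction.
Variables w m h P : nat.

(** The label points fill the columns [2w+2] to [2w+1+m], then all columns strictly between [colL]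
    and [colR], then [colR+2] to [colR+1+m]. The free column after [colR] keeps two neighbours of
    one [v_a] at horizontal distance at least three, which excludes 4-cycles through [v_a]. *)
Definition colL := 2 * w + m + 3.
Definition colR := colL + m + 1.
Definition colZ := colR + m + 3.
Definition width := (colZ + 2 * w).+1.
Definition height := (2 * h).+1.

Definition vertical X := [|| (X <= 2 * w) && ~~ odd X, X == colL, X == colR
  | (colZ <= X) && ~~ odd (X - colZ)].
(** Even levels are the rows, so every [P]-th row has a level divisible by [2 * P]; odd levels hold
    the subdivision vertices of the vertical paths. *)
Definition inS X Y := ~~ odd Y || vertical X.
Definition special Y := 2 * P %| Y.
Definition touch a X Y := ~~ odd Y &&
  [|| X == 2 * w + 1 + a, X == colR + 1 + a | (X + a == colR) && special Y].

(* The grid points that violate [inS] are kept as isolated vertices; [inr i] is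
   the column vertex with label [i.+1]. *)
Definition gvertex : finType := ('I_width * 'I_height + 'I_m)%type.

Definition gadj : rel gvertex := fun p q =>
  match p, q with
  | inl p, inl q => [&& inS p.1 p.2, inS q.1 q.2 & grid_adj p q]
  | inl p, inr i => touch i.+1 p.1 p.2
  | inr i, inl p => touch i.+1 p.1 p.2
  | inr _, inr _ => false
  end.

Lemma gadj_sym : symmetric gadj.
Proof. by case=> p [] q //=; rewrite grid_adj_sym andbCA. Qed.

Lemma gadj_irrefl : irreflexive gadj.
Proof. by case=> //= -[X Y]; rewrite /grid_adj /=; lia. Qed.

Definition canvas : sgraph := SGraph gadj_sym gadj_irrefl.

Hypothesis wm : 2 * w < m.

Lemma vertical_step X : vertical X -> ~~ vertical X.+1.
Proof. rewrite /vertical /colZ /colR /colL; lia. Qed.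

Lemma touch_inj a b X Y : 0 < a <= m -> 0 < b <= m ->
  touch a X Y -> touch b X Y -> a = b.
Proof. rewrite /touch /colZ /colR /colL; lia. Qed.

Lemma touch_vertical a X Y : 0 < a <= m -> touch a X Y -> ~~ vertical X.
Proof. rewrite /touch /vertical /colZ /colR /colL; lia. Qed.

Lemma touch_even a X Y : touch a X Y -> ~~ odd Y.
Proof. by case/andP. Qed.

Lemma touch_horizontal a X X' Y Y' : 0 < a <= m ->
  touch a X Y -> touch a X' Y' -> [|| X == X', X.+2 < X' | X'.+2 < X].
Proof. rewrite /touch /colZ /colR /colL; lia. Qed.

Lemma touch_same_label a (p q : 'I_width * 'I_height) : 0 < a <= m -> touch a p.1 p.2 -> touch a q.1 q.2 ->
  ~~ grid_adj p q.
Proof.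
move=> am tp tq; apply/negP; rewrite /grid_adj.
have := touch_horizontal am tp tq; have := touch_even tp; have := touch_even tq.
lia.
Qed.

Lemma touch_common a (p q r : 'I_width * 'I_height) : 0 < a <= m -> touch a p.1 p.2 -> touch a q.1 q.2 ->
  p != q -> inS r.1 r.2 ->
  grid_adj p r -> grid_adj q r -> False.
Proof.
move=> am tp tq; rewrite -pair_eqE /pair_eq -!val_eqE /=.
have hp := touch_horizontal am tp tq; have ep := touch_even tp.
have eq := touch_even tq; have vp := touch_vertical am tp.
have vq := touch_vertical am tq.
rewrite /grid_adj /inS => pq rS pr qr.
have : (p.1 == r.1 :> nat) || (p.1 != r.1 :> nat) by case: eqP.
case/orP=> h1; last by lia.
by move: vp; rewrite (eqP h1) => /negPf vr; rewrite vr orbF in rS; lia.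
Qed.

Lemma canvas_no_triangle (x y v : canvas) : adj x y -> adj y v -> adj v x -> False.
Proof.
have main i (p q : 'I_width * 'I_height) :
    gadj (inr i) (inl p) -> gadj (inl p) (inl q) -> gadj (inl q) (inr i) -> False.
  move=> /= tp /and3P[_ _ pq] tq.
  by have := touch_same_label _ tp tq; rewrite pq ltn_ord => /(_ isT).
case: x => [x|i]; case: y => [y|j]; case: v => [v|k] //.
- by move=> /= /and3P[_ _ h1] /and3P[_ _ h2] /and3P[_ _]; move: h1 h2; rewrite /grid_adj; lia.
- by move=> h1 h2 h3; apply: (main k x y).
- by move=> h1 h2 h3; apply: (main j v x).
- by move=> h1 h2 h3; apply: (main i y v).
Qed.

(** Two neighbours of a column vertex have no other common neighbour. A 4-cycle of grid points would
    be a unit square, and its odd level would need two consecutive vertical columns. *)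
Lemma canvas_no_square (x y u v : canvas) : x != y -> u != v ->
  adj x u -> adj x v -> adj y u -> adj y v -> False.
Proof.
have main i (y0 u0 v0 : canvas) : inr i != y0 -> u0 != v0 ->
    gadj (inr i) u0 -> gadj (inr i) v0 -> gadj y0 u0 -> gadj y0 v0 -> False.
  case: u0 v0 => [p|//] [q|//] iy pq /= tp tq.
  have am : 0 < i.+1 <= m by rewrite ltn_ord.
  case: y0 iy => [r|j] ij.
    move=> /= /and3P[rS _ rp] /and3P[_ _ rq].
    by apply: (touch_common am tp tq pq rS); rewrite grid_adj_sym.
  move=> /= t1 _; have := touch_inj am _ tp t1; rewrite ltn_ord => /(_ isT) [e].
  by case/eqP: ij; congr inr; apply: val_inj.
have sym (p q : canvas) : adj p q -> gadj q p by move=> pq; rewrite gadj_sym.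
case: x y u v => [x|i] y u v; last exact: main.
case: y => [y|i] xy uv xu xv yu yv; last first.
  by apply: (main i (inl x) u v) => //; rewrite eq_sym.
case: u uv xu yu => [u|i] uv xu yu; last first.
  by apply: (main i v (inl x) (inl y)) => //; apply: sym.
case: v uv xv yv => [v|i] uv xv yv; last first.
  by apply: (main i (inl u) (inl x) (inl y)) => //; rewrite 1?eq_sym //; apply: sym.
have neq (p q : 'I_width * 'I_height) :
    inl 'I_m p != inl q -> p.1 <> q.1 :> nat \/ p.2 <> q.2 :> nat.
  case: p q => [a b] [c d] ne; have [ac|] := eqVneq a c; last first.
    by move/eqP=> ac; left=> /= /val_inj.
  by right=> /= /val_inj bd; rewrite ac bd eqxx in ne.
move/neq: xy => xy; move/neq: uv => uv.
have /and3P[xS uS xu'] := xu; have /and3P[yS vS yv'] := yv.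
have /and3P[_ _ xv'] := xv; have /and3P[_ _ yu'] := yu.
have [X Y UV] := unit_square xu' yu' xv' yv' xy uv.
have o : odd y.2 = ~~ odd x.2 by case: Y => <- /=; rewrite ?negbK.
have ab : vertical x.1 -> vertical y.1 -> False.
  by case: X => <- V V'; have := vertical_step V'; have := vertical_step V; rewrite ?V ?V'.
move: xS yS uS vS; rewrite /inS => xS yS uS vS.
by case: UV => -[e1 e2 e3 e4];
  move: uS vS xS yS ab; rewrite e1 e2 e3 e4 o;
  case: (odd x.2); case: (vertical x.1); case: (vertical y.1) => //= _ _ _ _ /(_ isT isT).
Qed.

Lemma canvas_cycle5 (c : seq canvas) : is_cycle c -> 5 <= size c.
Proof.
case: c => [|x [|y [|v [|u [|x' c]]]]] [] //= /andP[] /=.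
  by move=> /and4P[xy yv vx _] _ _; case: (canvas_no_triangle xy yv vx).
move=> /and5P[xy yv vu ux _] /and3P[]; rewrite !inE !negb_or.
move=> /and3P[_ xv _] /andP[_ yu] _ _.
case: (@canvas_no_square x v y u) => //; by rewrite adj_sym.
Qed.

Definition pt X Y : canvas := inl (inord X : 'I_width, inord Y : 'I_height).

Lemma adj_pt X Y X' Y' : X < width -> Y < height -> X' < width -> Y' < height ->
  adj (pt X Y) (pt X' Y') = [&& inS X Y, inS X' Y' & step X Y X' Y'].
Proof. by move=> h1 h2 h3 h4; rewrite /= /grid_adj /= !inordK. Qed.

Lemma adj_pt_col X Y (i : 'I_m) : X < width -> Y < height ->
  @adj canvas (pt X Y) (inr i) = touch i.+1 X Y.
Proof. by move=> h1 h2; rewrite /= !inordK. Qed.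

Lemma adj_col_pt X Y (i : 'I_m) : X < width -> Y < height ->
  @adj canvas (inr i) (pt X Y) = touch i.+1 X Y.
Proof. by move=> h1 h2; rewrite /= !inordK. Qed.

Lemma pt_inj X Y X' Y' : X < width -> Y < height -> X' < width -> Y' < height ->
  pt X Y = pt X' Y' -> X = X' /\ Y = Y'.
Proof.
move=> h1 h2 h3 h4 [/(congr1 val)/= + /(congr1 val)/=].
by rewrite !inordK.
Qed.

Lemma canvas_girth : has_girth canvas 5.
Proof.
split; last exact: canvas_cycle5.
have m0 : 0 < m by lia.
(* Row 0 is special, so the column vertex with label 1 closes the path of four points around
   [colR]. *)
exists [:: inr (Ordinal m0) : canvas; pt (colR - 1) 0; pt colR 0; pt (colR + 1) 0;
           pt (colR + 2) 0] => //.
have b X : X <= colR + 2 -> X < width by rewrite /width /colZ; lia.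
have R3 : 3 < colR by rewrite /colR /colL; lia.
have c5 (T : eqType) (e : rel T) x1 x2 x3 x4 x5 : e x1 x2 -> e x2 x3 -> e x3 x4 ->
    e x4 x5 -> e x5 x1 -> cycle e [:: x1; x2; x3; x4; x5].
  by move=> /= -> -> -> -> ->.
split=> //; apply/andP; split.
  apply: c5.
  - rewrite adj_col_pt ?b //; last by lia.
    by rewrite /touch /special dvdn0 /=; lia.
  - by rewrite adj_pt ?b // /inS /step /=; lia.
  - by rewrite adj_pt ?b // /inS /step /=; lia.
  - by rewrite adj_pt ?b // /inS /step /=; lia.
  - by rewrite adj_pt_col ?b // /touch /=; lia.
have ne X X' : X < X' -> X' <= colR + 2 -> (pt X 0 == pt X' 0) = false.
  move=> h1 h2; apply/eqP => /pt_inj; rewrite !b //; last by lia.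
  by move=> /(_ isT isT isT isT) []; lia.
rewrite !cons_uniq !inE !ne ?andbT; try lia; by [].
Qed.

End Construction.

(** * Cutting the graph along a column *)

Section GridSegments.
Variables A B : nat.
Implicit Types f g : nat -> nat -> bool.

Definition cells (f : nat -> nat -> bool) : {set 'I_A * 'I_B} :=
  [set p : 'I_A * 'I_B | f p.1 p.2].

Lemma cellsP f x y (xA : x < A) (yB : y < B) :
  ((Ordinal xA, Ordinal yB) \in cells f) = f x y.
Proof. by rewrite inE. Qed.

Lemma linked_cells f g x y x' y' : x < A -> y < B -> x' < A -> y' < B ->
  f x y -> g x' y' -> (x == x') && (y == y') || step x y x' y' ->
  linked (@grid_adj A B) (cells f) (cells g).
Proof.
move=> xA yB xA' yB' fxy gxy h.
exists (Ordinal xA, Ordinal yB), (Ordinal xA', Ordinal yB').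
by rewrite !cellsP; split=> //; rewrite xpair_eqE -!val_eqE.
Qed.

Lemma eq_cells f g : (forall x y, x < A -> y < B -> f x y = g x y) -> cells f = cells g.
Proof. by move=> fg; apply/setP=> -[x y]; rewrite !inE fg. Qed.

Lemma econ_cell x y : x < A -> y < B ->
  econ (@grid_adj A B) (cells (fun x' y' => (x' == x) && (y' == y))).
Proof.
move=> xA yB; have -> : cells (fun x' y' => (x' == x) && (y' == y)) =
  [set (Ordinal xA, Ordinal yB)].
  by apply/setP=> -[x' y']; rewrite !inE xpair_eqE -!val_eqE.
exact: econ1.
Qed.

Lemma econ_cellsU f g : econ (@grid_adj A B) (cells f) -> econ (@grid_adj A B) (cells g) ->
  linked (@grid_adj A B) (cells f) (cells g) ->
  econ (@grid_adj A B) (cells (fun x y => f x y || g x y)).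
Proof.
move=> cf cg l; have -> : cells (fun x y => f x y || g x y) = cells f :|: cells g.
  by apply/setP=> p; rewrite !inE.
by apply: econU => //; apply: grid_adj_sym.
Qed.

Lemma econ_vseg x l r : x < A -> l <= r -> r < B ->
  econ (@grid_adj A B) (cells (fun x' y => (x' == x) && (l <= y <= r))).
Proof.
move=> xA; elim: r => [|r IH] lr rB.
  rewrite (@eq_cells _ (fun x' y => (x' == x) && (y == 0))); last by move=> *; lia.
  exact: econ_cell.
have [lr'|lr'] := ltnP l r.+1; last first.
  rewrite (@eq_cells _ (fun x' y => (x' == x) && (y == r.+1))); last by move=> *; lia.
  exact: econ_cell.
rewrite (@eq_cells _ (fun x' y => (x' == x) && (l <= y <= r) || (x' == x) && (y == r.+1)));
  last by move=> *; lia.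
apply: econ_cellsU; [by apply: IH; lia | exact: econ_cell |].
by apply: (@linked_cells _ _ x r x r.+1); rewrite /step; lia.
Qed.

Lemma econ_hseg y l r : y < B -> l <= r -> r < A ->
  econ (@grid_adj A B) (cells (fun x y' => (y' == y) && (l <= x <= r))).
Proof.
move=> yB; elim: r => [|r IH] lr rA.
  rewrite (@eq_cells _ (fun x y' => (x == 0) && (y' == y))); last by move=> *; lia.
  exact: econ_cell.
have [lr'|lr'] := ltnP l r.+1; last first.
  rewrite (@eq_cells _ (fun x y' => (x == r.+1) && (y' == y))); last by move=> *; lia.
  exact: econ_cell.
rewrite (@eq_cells _ (fun x y' => (y' == y) && (l <= x <= r) || (x == r.+1) && (y' == y)));
  last by move=> *; lia.
apply: econ_cellsU; [by apply: IH; lia | exact: econ_cell |].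
by apply: (@linked_cells _ _ r y r.+1 y); rewrite /step; lia.
Qed.

End GridSegments.

Section Cut.
Variables w m h P : nat.
Hypothesis wm : 2 * w < m.
Variable a : nat.
Hypothesis am : 0 < a <= m.

Local Notation L := (colL w m).
Local Notation R := (colR w m).
Local Notation Hh := (height h).
Local Notation W := (width w m).
Local Notation special := (special P).
Local Notation touch := (touch w m P).
Local Notation vertical := (vertical w m).
Local Notation inS := (inS w m).
(** Since [C = R - 2 * w], a single shift of the middle part puts label [b] on the line [x = b] when
    it is counted from the left bundle and on [x = C + b] when it is counted from [R]. The bound
    [2 * w < m] keeps both shifted bundles away from the opposite side of the frame. Every level is
    doubled to make room for the special rows. *)
Let C := 2 * m + 4.
Let hostX := C + m + 1.
Let hostY := 6 * Hh + 2.
Local Notation gridE := (@grid_adj hostX hostY).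

(* The drawing of [canvas] cut open along column [a]: the three parts of the
   canvas are stacked above each other, rows entering a part come from the left
   and rows leaving it go to the right, so that all points with label [b] lie on
   one of the two vertical lines [x = b], [x = C + b]. *)
Definition frame x y := [|| x == a, x == C + a | (y == 0) && (a <= x <= C + a)].

(** All neighbours of the column vertex [a] become the same frame, on which the cut rows end;
    [no_model] tolerates this overlap. The points of a special row strictly between [L] and [R] move
    to the second copy of its level, and there [L] and [R] receive the extra cells [m + 1] and [C]
    to reach them. *)
Definition own_pt X Y x y : bool :=
  if touch a X Y then frame x y else
  if X <= 2 * w + a then
    (x + 2 * w + 1 == X + C) && ((y == 1 + 2 * Y) || vertical X && (y == 2 + 2 * Y)) else
  if [&& special Y, L < X & X < R] then
    (y == 2 + 2 * Hh + 2 * Y) && (x == if R - X < a then C + (R - X) else R - X) else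
  if X <= R + a then
    (x + R + 1 == X + C) &&
      ((y == 1 + 2 * Hh + 2 * Y) || vertical X && (y == 2 + 2 * Hh + 2 * Y))
    || [&& special Y, y == 2 + 2 * Hh + 2 * Y &
        (X == R) && (x == C) || (X == L) && (x == m + 1)] else
  (x + R + 1 == X) && ((y == 1 + 4 * Hh + 2 * Y) || vertical X && (y == 2 + 4 * Hh + 2 * Y)).

(** Level 0 is left to the frame, whose closing side passes across all these lines there. *)
Definition own_col b x y : bool := (0 < y) && (if b < a then x == C + b else x == b).

Inductive own_spec X Y x y : Prop :=
| OwnFrame of touch a X Y & frame x y
| OwnL of X <= 2 * w + a & x + 2 * w + 1 = X + C &
    y = 1 + 2 * Y \/ vertical X /\ y = 2 + 2 * Y
| OwnS b of special Y & X + b = R & 0 < b <= m & y = 2 + 2 * Hh + 2 * Y &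
    b < a /\ x = C + b \/ a < b /\ x = b
| OwnM of 2 * w + 1 + a < X < R + 1 + a & x + R + 1 = X + C &
    y = 1 + 2 * Hh + 2 * Y \/ (X = L \/ X = R) /\ y = 2 + 2 * Hh + 2 * Y
| OwnE of special Y & y = 2 + 2 * Hh + 2 * Y & X = R /\ x = C \/ X = L /\ x = m + 1
| OwnR of R + 1 + a < X & x + R + 1 = X &
    y = 1 + 4 * Hh + 2 * Y \/ vertical X /\ y = 2 + 4 * Hh + 2 * Y.

Lemma touch_pos X Y : touch a X Y ->
  [\/ X = 2 * w + 1 + a, X = R + 1 + a | X + a = R /\ special Y].
Proof.
move=> /andP[_ /or3P[/eqP|/eqP|/andP[/eqP ? ?]]];
  by [constructor 1 | constructor 2 | constructor 3].
Qed.

Let RE : R = 2 * w + C. Proof. by rewrite /colR /colL /C; lia. Qed.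
Let LE : L = 2 * w + m + 3. Proof. by []. Qed.
Let WE : W = (R + m + 3 + 2 * w).+1. Proof. by []. Qed.
Let hXE : hostX = C + m + 1. Proof. by []. Qed.
Let hYE : hostY = 6 * Hh + 2. Proof. by []. Qed.
Let CE : C = 2 * m + 4. Proof. by []. Qed.

Lemma verticalM X : vertical X -> 2 * w + a < X <= R + a -> X = L \/ X = R.
Proof. by rewrite /vertical /colZ; lia. Qed.

Lemma inS_touch b X Y : 0 < b <= m -> inS X Y ->
  X = 2 * w + 1 + b \/ X = R + 1 + b -> touch b X Y.
Proof.
move=> bm; have nv : vertical (2 * w + 1 + b) = false /\ vertical (R + 1 + b) = false.
  by split; apply/negP; rewrite /vertical /colZ; lia.
by move=> + [] e; rewrite /inS e ?nv.1 ?nv.2 orbF /touch => ->; rewrite eqxx ?orbT.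
Qed.

Lemma inS_touch_special b X Y : special Y -> X + b = R -> touch b X Y.
Proof.
move=> s e; rewrite /touch s e eqxx !orbT andbT.
by move: s => /dvdnP[k ->]; lia.
Qed.

Lemma own_L X Y x y : X <= 2 * w + a -> own_pt X Y x y =
  (x + 2 * w + 1 == X + C) && ((y == 1 + 2 * Y) || vertical X && (y == 2 + 2 * Y)).
Proof.
move=> h1; rewrite /own_pt h1; case: ifP => // /touch_pos; case; lia.
Qed.

Lemma own_S b X Y x y : special Y -> X + b = R -> 0 < b <= m -> b != a ->
  own_pt X Y x y = (y == 2 + 2 * Hh + 2 * Y) && (x == if b < a then C + b else b).
Proof.
move=> s e b0 ba; rewrite /own_pt; have -> : R - X = b by lia.
case: ifP => [/touch_pos[]|_]; [lia | lia | lia |].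
have -> : (X <= 2 * w + a) = false by lia.
by have -> : [&& special Y, L < X & X < R] by rewrite s; lia.
Qed.

Lemma own_M X Y x y : 2 * w + 1 + a < X < R + 1 + a -> ~~ [&& special Y, L < X & X < R] ->
  own_pt X Y x y = (x + R + 1 == X + C) &&
      ((y == 1 + 2 * Hh + 2 * Y) || vertical X && (y == 2 + 2 * Hh + 2 * Y))
    || [&& special Y, y == 2 + 2 * Hh + 2 * Y &
        (X == R) && (x == C) || (X == L) && (x == m + 1)].
Proof.
move=> h1 /negPf h2; rewrite /own_pt h2.
case: ifP => [/touch_pos[e|e|[e s]]|_]; [lia | lia | |].
  by exfalso; move: h2; rewrite s; lia.
have -> : (X <= 2 * w + a) = false by lia.
by have -> : X <= R + a by lia.
Qed.

Lemma own_R X Y x y : R + 1 + a < X -> own_pt X Y x y =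
  (x + R + 1 == X) && ((y == 1 + 4 * Hh + 2 * Y) || vertical X && (y == 2 + 4 * Hh + 2 * Y)).
Proof.
move=> h1; rewrite /own_pt; case: ifP => [/touch_pos[]|_]; [lia | lia | lia |].
have -> : (X <= 2 * w + a) = false by lia.
have -> : (X < R) = false by lia.
rewrite !andbF; have -> : (X <= R + a) = false by lia.
by [].
Qed.

Variant point_spec X Y : Prop :=
| PtTouch of touch a X Y
| PtL of X <= 2 * w + a
| PtS b of special Y & X + b = R & 0 < b <= m & b != a
| PtM of 2 * w + 1 + a < X < R + 1 + a & ~~ [&& special Y, L < X & X < R]
| PtR of R + 1 + a < X.

Lemma pointP X Y : inS X Y -> point_spec X Y.
Proof.
move=> S; have [t|nt] := boolP (touch a X Y); first exact: PtTouch.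
have [h1|h1] := leqP X (2 * w + a); first exact: PtL.
have [e|ne] := eqVneq X (2 * w + 1 + a).
  by apply/PtTouch/(inS_touch am) => //; left.
have [e'|ne'] := eqVneq X (R + 1 + a).
  by apply/PtTouch/(inS_touch am) => //; right.
have [h2|h2] := leqP X (R + a); last by apply: PtR; lia.
have [/and3P[s h3 h4]|ns] := boolP [&& special Y, L < X & X < R]; last first.
  by apply: PtM => //; lia.
apply: (PtS (b := R - X)) => //; [lia | lia |].
by apply/eqP=> e; rewrite inS_touch_special // in nt; lia.
Qed.

Lemma own_ptP X Y x y : inS X Y -> own_pt X Y x y -> own_spec X Y x y.
Proof.
move=> /pointP[t|h1|b s e b0 ba|h1 h2|h1].
- by rewrite /own_pt t; apply: OwnFrame.
- by rewrite own_L // => /andP[/eqP ? ?]; apply: OwnL; lia.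
- rewrite (own_S _ _ s e b0 ba) => /andP[/eqP hy /eqP hx].
  by apply: (OwnS (b := b)) => //; move: hx; case: ifP; lia.
- rewrite own_M // => /orP[/andP[/eqP hx hy]|/and3P[s /eqP hy hx]].
    apply: OwnM => //; case/orP: hy => [|/andP[V]] /eqP ->; first by left.
    by right; split=> //; apply: verticalM => //; lia.
  by apply: OwnE => //; lia.
- by rewrite own_R // => /andP[/eqP ? ?]; apply: OwnR; lia.
Qed.

Lemma own_pt_econ X Y : X < W -> Y < Hh -> inS X Y ->
  econ gridE (cells hostX hostY (own_pt X Y)).
Proof.
move=> XW YH /pointP[t|h1|b s e b0 ba|h1 h2|h1].
- rewrite (@eq_cells _ _ _ (fun x y => (x == a) && (0 <= y <= hostY.-1) ||
    ((x == C + a) && (0 <= y <= hostY.-1) || (y == 0) && (a <= x <= C + a)))); last first.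
    move=> x y xA yB; rewrite /own_pt t /frame.
    have -> : 0 <= y <= hostY.-1 by lia.
    by rewrite !andbT.
  apply: econ_cellsU; [by apply: econ_vseg; lia | |].
    apply: econ_cellsU; [by apply: econ_vseg; lia | by apply: econ_hseg; lia |].
    by apply: (@linked_cells _ _ _ _ (C + a) 0 (C + a) 0); lia.
  by apply: (@linked_cells _ _ _ _ a 0 a 0); lia.
- rewrite (@eq_cells _ _ _ (fun x y => (x == X + C - (2 * w + 1)) &&
    (1 + 2 * Y <= y <= 1 + 2 * Y + vertical X))).
    by apply: econ_vseg; case: (vertical X); lia.
  by move=> x y xA yB; rewrite own_L //; case: (vertical X); lia.
- rewrite (@eq_cells _ _ _ (fun x y => (x == if b < a then C + b else b) &&
    (y == 2 + 2 * Hh + 2 * Y))).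
    by apply: econ_cell; [case: ifP|]; lia.
  by move=> x y xA yB; rewrite (own_S _ _ s e b0 ba) andbC.
- have cM : econ gridE (cells hostX hostY (fun x y => (x == X + C - (R + 1)) &&
      (1 + 2 * Hh + 2 * Y <= y <= 1 + 2 * Hh + 2 * Y + vertical X))).
    by apply: econ_vseg; case: (vertical X); lia.
  have vL : vertical L by rewrite /vertical eqxx orbT.
  have vR : vertical R by rewrite /vertical eqxx !orbT.
  have [/andP[s XLR]|ns] := boolP (special Y && ((X == L) || (X == R))); last first.
    rewrite (eq_cells (g := (fun x y => (x == X + C - (R + 1)) &&
      (1 + 2 * Hh + 2 * Y <= y <= 1 + 2 * Hh + 2 * Y + vertical X)))) //.
    move=> x y xA yB; rewrite own_M //.
    have -> : [&& special Y, y == 2 + 2 * Hh + 2 * Y &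
        (X == R) && (x == C) || (X == L) && (x == m + 1)] = false.
      apply/negP=> /and3P[s _ xx]; case/negP: ns; rewrite s.
      by case/orP: xx => /andP[->]; rewrite ?orbT.
    by rewrite orbF; case: (vertical X); lia.
  have [e|e] : X = R \/ X = L by lia.
    rewrite (eq_cells (g := (fun x y => (x == X + C - (R + 1)) &&
      (1 + 2 * Hh + 2 * Y <= y <= 1 + 2 * Hh + 2 * Y + vertical X) ||
      (x == C) && (y == 2 + 2 * Hh + 2 * Y)))).
      apply: econ_cellsU => //; first by apply: econ_cell; lia.
      apply: (@linked_cells _ _ _ _ (C - 1) (2 + 2 * Hh + 2 * Y) C (2 + 2 * Hh + 2 * Y));
      by rewrite ?e ?vR /step; lia.
    move=> x y xA yB; rewrite own_M // s e vR eqxx.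
    have -> : (R == L) = false by lia.
    by rewrite /= orbF [(x == C) && _]andbC; congr (_ || _); lia.
  rewrite (eq_cells (g := (fun x y => (x == X + C - (R + 1)) &&
      (1 + 2 * Hh + 2 * Y <= y <= 1 + 2 * Hh + 2 * Y + vertical X) ||
      (x == m + 1) && (y == 2 + 2 * Hh + 2 * Y)))).
    apply: econ_cellsU => //; first by apply: econ_cell; lia.
    apply: (@linked_cells _ _ _ _ (m + 2) (2 + 2 * Hh + 2 * Y) (m + 1) (2 + 2 * Hh + 2 * Y));
    by rewrite ?e ?vL /step; lia.
  move=> x y xA yB; rewrite own_M // s e vL eqxx.
  have -> : (L == R) = false by lia.
  by rewrite /= [(x == m + 1) && _]andbC; congr (_ || _); lia.
- rewrite (@eq_cells _ _ _ (fun x y => (x == X - (R + 1)) &&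
    (1 + 4 * Hh + 2 * Y <= y <= 1 + 4 * Hh + 2 * Y + vertical X))).
    by apply: econ_vseg; case: (vertical X); lia.
  by move=> x y xA yB; rewrite own_R //; case: (vertical X); lia.
Qed.

Lemma in_T X Y x y : touch a X Y -> frame x y -> own_pt X Y x y.
Proof. by rewrite /own_pt => ->. Qed.

Lemma in_L X Y : X <= 2 * w + a -> own_pt X Y (X + C - (2 * w + 1)) (1 + 2 * Y).
Proof. by move=> h1; rewrite own_L // eqxx; lia. Qed.

Lemma in_S b X Y : special Y -> X + b = R -> 0 < b <= m -> b != a ->
  own_pt X Y (if b < a then C + b else b) (2 + 2 * Hh + 2 * Y).
Proof. by move=> s e b0 ba; rewrite (own_S _ _ s e b0 ba) !eqxx. Qed.

Lemma in_M X Y : 2 * w + 1 + a < X < R + 1 + a -> ~~ [&& special Y, L < X & X < R] ->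
  own_pt X Y (X + C - (R + 1)) (1 + 2 * Hh + 2 * Y).
Proof. by move=> h1 h2; rewrite own_M // eqxx; lia. Qed.

Lemma in_ER Y : special Y -> own_pt R Y C (2 + 2 * Hh + 2 * Y).
Proof.
by move=> s; rewrite own_M ?s ?eqxx ?orbT ?ltnn ?andbF //; lia.
Qed.

Lemma in_EL Y : special Y -> own_pt L Y (m + 1) (2 + 2 * Hh + 2 * Y).
Proof.
by move=> s; rewrite own_M ?s ?eqxx ?orbT ?ltnn ?andbF //; lia.
Qed.

Lemma in_R X Y : R + 1 + a < X -> own_pt X Y (X - (R + 1)) (1 + 4 * Hh + 2 * Y).
Proof. by move=> h1; rewrite own_R // eqxx; lia. Qed.

Local Notation lnk f g := (linked gridE (cells hostX hostY f) (cells hostX hostY g)).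

Lemma link_horizontal X Y : X.+1 < W -> Y < Hh -> inS X Y -> inS X.+1 Y ->
  lnk (own_pt X Y) (own_pt X.+1 Y).
Proof.
move=> XW YH /pointP[t|h1|b s e b0 ba|h1 h2|h1] /pointP[t'|h1'|b' s' e' b0' ba'|h1' h2'|h1'].
all: try (exfalso; lia).
- exfalso; case: (touch_pos t) => [e|e|[e _]]; case: (touch_pos t') => [e'|e'|[e' _]]; lia.
- exfalso; case: (touch_pos t) => [e|e|[e _]]; lia.
- case: (touch_pos t) => [e|e|[e _]]; [lia | lia |].
  have := in_S s' e' b0' ba'; have -> : b' < a by lia.
  move=> o; apply: (@linked_cells _ _ _ _ (C + a) (2 + 2 * Hh + 2 * Y) _ _ _ _ _ _
    (in_T t _) o); rewrite /step /frame; lia.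
- case: (touch_pos t) => [e|e|[e s]]; [| lia |].
    apply: (@linked_cells _ _ _ _ a (1 + 2 * Hh + 2 * Y) _ _ _ _ _ _
      (in_T t _) (in_M h1' h2')); rewrite /step /frame; lia.
  have eR : X.+1 = R by move: h2'; rewrite s; lia.
  rewrite eR; apply: (@linked_cells _ _ _ _ (C + a) (2 + 2 * Hh + 2 * Y) _ _ _ _ _ _
      (in_T t _) (in_ER s)); rewrite /step /frame; lia.
- case: (touch_pos t) => [e|e|[e s]]; [lia | | lia].
  apply: (@linked_cells _ _ _ _ a (1 + 4 * Hh + 2 * Y) _ _ _ _ _ _
      (in_T t _) (in_R _ h1')); rewrite /step /frame; lia.
- case: (touch_pos t') => [e|e|[e s]]; [| lia | lia].
  apply: (@linked_cells _ _ _ _ _ _ (C + a) (1 + 2 * Y) _ _ _ _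
      (in_L _ h1) (in_T t' _)); rewrite /step /frame; lia.
- apply: (@linked_cells _ _ _ _ _ _ _ _ _ _ _ _ (in_L _ h1) (in_L _ h1'));
  rewrite /step; lia.
- case: (touch_pos t') => [e'|e'|[e' _]]; [lia | lia |].
  have := in_S s e b0 ba; have -> : (b < a) = false by lia.
  move=> o; apply: (@linked_cells _ _ _ _ _ _ a (2 + 2 * Hh + 2 * Y) _ _ _ _
    o (in_T t' _)); rewrite /step /frame; lia.
- have := in_S s e b0 ba; have := in_S s' e' b0' ba'.
  have -> : (b' < a) = (b < a) by lia.
  by case: ifP => h1 o' o; apply: (@linked_cells _ _ _ _ _ _ _ _ _ _ _ _ o o');
    rewrite /step; lia.
- have eR : X.+1 = R by move: h2'; rewrite s; lia.
  have := in_S s e b0 ba; have -> : b < a by lia.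
  by move=> o; rewrite eR; apply: (@linked_cells _ _ _ _ _ _ _ _ _ _ _ _ o (in_ER s));
    rewrite /step; lia.
- case: (touch_pos t') => [e'|e'|[e' s]]; [lia | |].
    apply: (@linked_cells _ _ _ _ _ _ (C + a) (1 + 2 * Hh + 2 * Y) _ _ _ _
      (in_M h1 h2) (in_T t' _)); rewrite /step /frame; lia.
  have eL : X = L by move: h2; rewrite s; lia.
  rewrite {1}eL; apply: (@linked_cells _ _ _ _ _ _ a (2 + 2 * Hh + 2 * Y) _ _ _ _
      (in_EL s) (in_T t' _)); rewrite /step /frame; lia.
- have eL : X = L by move: h2; rewrite s'; lia.
  have := in_S s' e' b0' ba'; have -> : (b' < a) = false by lia.
  by move=> o; rewrite {1}eL; apply: (@linked_cells _ _ _ _ _ _ _ _ _ _ _ _ (in_EL s') o);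
    rewrite /step; lia.
- apply: (@linked_cells _ _ _ _ _ _ _ _ _ _ _ _ (in_M h1 h2) (in_M h1' h2'));
  rewrite /step; lia.
- exfalso; case: (touch_pos t') => [e|e|[e _]]; lia.
- apply: (@linked_cells _ _ _ _ _ _ _ _ _ _ _ _ (in_R _ h1) (in_R _ h1'));
  rewrite /step; lia.
Qed.

Lemma link_vertical X Y : X < W -> Y.+1 < Hh -> vertical X ->
  lnk (own_pt X Y) (own_pt X Y.+1).
Proof.
move=> XW YH V.
have [h1|h1] := leqP X (2 * w + a).
  apply: (@linked_cells _ _ _ _ (X + C - (2 * w + 1)) (2 + 2 * Y) _ _ _ _ _ _ _ (in_L _ h1));
  rewrite ?own_L ?V /step; lia.
have [h2|h2] := leqP X (R + a).
  have LR : X = L \/ X = R by apply: verticalM => //; lia.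
  have h3 Y' : ~~ [&& special Y', L < X & X < R] by lia.
  have h4 : 2 * w + 1 + a < X < R + 1 + a by lia.
  apply: (@linked_cells _ _ _ _ (X + C - (R + 1)) (2 + 2 * Hh + 2 * Y) _ _ _ _ _ _ _
    (in_M h4 (h3 _))); rewrite ?own_M ?V ?h3 /step; lia.
have h4 : R + 1 + a < X by move: V; rewrite /vertical /colZ; lia.
apply: (@linked_cells _ _ _ _ (X - (R + 1)) (2 + 4 * Hh + 2 * Y) _ _ _ _ _ _ _
    (in_R _ h4)); rewrite ?own_R ?V /step; lia.
Qed.

Lemma link_step X Y X' Y' : X < W -> X' < W -> Y < Hh -> Y' < Hh ->
  inS X Y -> inS X' Y' -> step X Y X' Y' -> lnk (own_pt X Y) (own_pt X' Y').
Proof.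
have vert Z T : inS Z T -> inS Z T.+1 -> vertical Z.
  by rewrite /inS /= negbK; case: (odd T).
move=> XW XW' YH YH' S S' /orP[]/andP[/eqP e /orP[]/eqP e'].
- by subst; apply: link_vertical (vert _ _ S S').
- by subst; apply: linkedC; [exact: grid_adj_sym | apply: link_vertical (vert _ _ S' S)].
- by subst; apply: link_horizontal.
- by subst; apply: linkedC; [exact: grid_adj_sym | apply: link_horizontal].
Qed.

Lemma link_col b X Y : 0 < b <= m -> b != a -> X < W -> Y < Hh -> touch b X Y ->
  lnk (own_pt X Y) (own_col b).
Proof.
move=> bm ba XW YH /andP[_ /or3P[/eqP e|/eqP e|/andP[/eqP e s]]].
- have [h1|h1] := ltnP b a.
    have h2 : X <= 2 * w + a by lia.
    apply: (@linked_cells _ _ _ _ _ _ (C + b) (1 + 2 * Y) _ _ _ _ (in_L _ h2));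
    rewrite /own_col ?h1 /step; lia.
  have h2 : 2 * w + 1 + a < X < R + 1 + a by lia.
  have h3 : ~~ [&& special Y, L < X & X < R] by lia.
  have hf : (b < a) = false by lia.
  apply: (@linked_cells _ _ _ _ _ _ b (1 + 2 * Hh + 2 * Y) _ _ _ _ (in_M h2 h3));
  rewrite /own_col ?hf /step; lia.
- have [h1|h1] := ltnP b a.
    have h2 : 2 * w + 1 + a < X < R + 1 + a by lia.
    have h3 : ~~ [&& special Y, L < X & X < R] by lia.
    apply: (@linked_cells _ _ _ _ _ _ (C + b) (1 + 2 * Hh + 2 * Y) _ _ _ _ (in_M h2 h3));
    rewrite /own_col ?h1 /step; lia.
  have h2 : R + 1 + a < X by lia.
  have hf : (b < a) = false by lia.
  apply: (@linked_cells _ _ _ _ _ _ b (1 + 4 * Hh + 2 * Y) _ _ _ _ (in_R _ h2));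
  rewrite /own_col ?hf /step; lia.
have := in_S s e bm ba; case: ifP => h1 o.
  apply: (@linked_cells _ _ _ _ _ _ (C + b) (2 + 2 * Hh + 2 * Y) _ _ _ _ o);
  rewrite /own_col ?h1 /step; lia.
apply: (@linked_cells _ _ _ _ _ _ b (2 + 2 * Hh + 2 * Y) _ _ _ _ o);
rewrite /own_col ?h1 /step; lia.
Qed.

(** The three parts occupy disjoint ranges of [y]. In the middle part odd [y] carry the rows, and
    even [y] only [L], [R] and the pieces of special rows, whose abscissas differ. No other cell
    lies on the frame. *)
Lemma own_pt_inj X Y X' Y' x y : X < W -> X' < W -> Y < Hh -> Y' < Hh ->
  inS X Y -> inS X' Y' -> own_pt X Y x y -> own_pt X' Y' x y ->
  X = X' /\ Y = Y' \/ touch a X Y && touch a X' Y'.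
Proof.
move=> XW XW' YH YH' S S'.
move=> /(own_ptP S)[t f|h1 h2 h3|b h1 h2 h3 h4 h5|h1 h2 h3|h1 h2 h3|h1 h2 h3].
all: move=> /(own_ptP S')[t' f'|g1 g2 g3|b' g1 g2 g3 g4 g5|g1 g2 g3|g1 g2 g3|g1 g2 g3].
1: by right; rewrite t t'.
1-5: by exfalso; move: f; rewrite /frame; lia.
1: by exfalso; move: f'; rewrite /frame; lia.
6: by exfalso; move: f'; rewrite /frame; lia.
11: by exfalso; move: f'; rewrite /frame; lia.
16: by exfalso; move: f'; rewrite /frame; lia.
21: by exfalso; move: f'; rewrite /frame; lia.
all: left; lia.
Qed.

Lemma own_col_pt b X Y x y : 0 < b <= m -> b != a -> X < W -> Y < Hh -> inS X Y ->
  own_pt X Y x y -> own_col b x y -> touch b X Y.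
Proof.
move=> bm ba XW YH S o /andP[y0 oc]; have {oc} : b < a /\ x = C + b \/ a < b /\ x = b.
  by move: oc; case: ifP; lia.
move=> oc; case: (own_ptP S o) => [t f|h1 h2 h3|c h1 h2 h3 h4 h5|h1 h2 h3|h1 h2 h3|h1 h2 h3].
- by exfalso; move: f; rewrite /frame; lia.
- by apply: inS_touch => //; left; lia.
- by apply: inS_touch_special => //; lia.
- by apply: inS_touch => //; lia.
- by exfalso; lia.
- by apply: inS_touch => //; right; lia.
Qed.

Lemma own_col_inj b b' x y : 0 < b <= m -> 0 < b' <= m -> b != a -> b' != a ->
  own_col b x y -> own_col b' x y -> b = b'.
Proof. by move=> bm bm' ba ba'; rewrite /own_col; case: ifP; case: ifP; lia. Qed.

Lemma own_col_econ b : 0 < b <= m -> econ gridE (cells hostX hostY (own_col b)).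
Proof.
move=> bm; rewrite (@eq_cells _ _ _ (fun x y => (x == if b < a then C + b else b) &&
  (1 <= y <= hostY.-1))).
  by apply: econ_vseg; [case: ifP|..]; lia.
by move=> x y xA yB; rewrite /own_col; case: ifP; lia.
Qed.

End Cut.

(** * Excluding the subdivided complete graph *)

Section Model.
Variables (G : sgraph) (X : subdiv (complete 6) -> {set G}).
Hypotheses (cX : forall v, connected (induced (X v)))
  (dX : forall u v, u != v -> [disjoint X u & X v])
  (jX : forall u v, u != v -> (joined (X u) (X v) <-> adj u v)).

(** The value [inl i] is a default, taken when [i = j]. *)
Definition edge_vertex (i j : complete 6) : subdiv (complete 6) :=
  if insub [set i; j] is Some e then inr e else inl i.

Lemma edge_vertexP (i j : complete 6) : i != j ->
  exists2 e : {A : {set complete 6} | A \in edges (complete 6)},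
    edge_vertex i j = inr e & val e = [set i; j].
Proof.
move=> ij; rewrite /edge_vertex; case: insubP => [e _ <-|]; first by exists e.
rewrite inE => /existsP[]; exists i; apply/existsP; exists j.
by rewrite /= ij eqxx.
Qed.

Lemma model_uniq u v g : g \in X u -> g \in X v -> u = v.
Proof.
move=> gu gv; apply/eqP/negP=> /negP uv.
by rewrite (disjointFr (dX uv) gu) in gv.
Qed.

Lemma model_anti u v g g' : u != v -> ~~ adj u v -> g \in X u -> g' \in X v ->
  (g != g') && ~~ adj g g'.
Proof.
move=> uv nuv gu gv; apply/andP; split.
  by apply: contraNneq uv => gg; apply/eqP/(@model_uniq _ _ g); rewrite // gg.
by apply: contraNN nuv => gg; apply/(jX uv); exists g, g'.
Qed.

(** This keeps the isolated grid points, which violate [inS], out of every bag. *)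
Lemma model_neighbor v g : g \in X v -> exists g', adj g g'.
Proof.
move=> gv.
have [u uv vu] : exists2 u, v != u & adj v u.
  case: v {gv} => [i|e].
    have [j ij] : exists j : 'I_6, i != j.
      by exists (if i == ord0 then ord_max else ord0); case: (i =P ord0) => [->|/eqP].
    have [e _ ve] := edge_vertexP ij.
    by exists (inr e) => //=; rewrite ve !inE eqxx.
  have := valP e; rewrite inE => /existsP[i /existsP[j /andP[_ /eqP ve]]].
  by exists (inl i) => //=; rewrite ve !inE eqxx.
have [x [y [xv yu xy]]] := (jX uv).2 vu.
have [_ /(_ g x gv xv)/connectP[[|z p]]] := cX v.
  by move=> _ /= <-; exists y.
by move=> /= /andP[/and3P[_ _ gz] _] _; exists z.
Qed.

Definition avoids (p : complete 6) (v : subdiv (complete 6)) :=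
  match v with inl i => i != p | inr e => p \notin val e end.

(* Van Kampen's argument for the five indices different from [p]; regions of
   two nonadjacent vertices may meet if both vertices belong to the branch set
   of one common index [q]. *)
Lemma no_model a b (rho : G -> {set 'I_a * 'I_b}) (N : pred G) p q :
  let U := \bigcup_(v | avoids p v) X v in
  (forall g, g \in U -> econ (@grid_adj a b) (rho g)) ->
  (forall g g', g \in U -> g' \in U -> adj g g' ->
     linked (@grid_adj a b) (rho g) (rho g')) ->
  (forall g g', g \in U -> g' \in U -> g != g' -> ~~ adj g g' -> ~~ (N g && N g') ->
     [disjoint rho g & rho g']) ->
  (forall v g, avoids p v -> g \in X v -> N g -> v = inl q) ->
  False.
Proof.
move=> U cr lr dr Nq; pose f := lift p : 'I_5 -> 'I_6.
have fp i : f i != p by rewrite eq_sym neq_lift.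
have fI i j : i != j -> f i != f j by apply: contraNneq => /lift_inj->.
have aB i : avoids p (inl (f i)) by apply: fp.
have aS i j : i != j -> avoids p (edge_vertex (f i) (f j)).
  move=> /fI/edge_vertexP[e -> /= ->].
  by rewrite !inE negb_or ![p == _]eq_sym !fp.
pose D i j := X (inl (f i)) :|: X (edge_vertex (f i) (f j)) :|: X (inl (f j)).
have DU i j : i != j -> D i j \subset U.
  by move=> ij; rewrite !subUset; apply/andP; split; [apply/andP; split|];
    apply: bigcup_sup; auto.
have DP i j g : i != j -> g \in D i j -> exists v, [/\ avoids p v, g \in X v &
    v = inl (f i) \/ v = inl (f j) \/ v = edge_vertex (f i) (f j)].
  by move=> ij; rewrite !inE => /orP[/orP[]|] gX; eexists; split; try exact: gX; auto.
have cD i j : i != j -> econ (@adj G) (D i j).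
  move=> ij; have [e ee ve] := edge_vertexP (fI i j ij).
  have lnk u v : u != v -> adj u v -> linked (@adj G) (X u) (X v).
    by move=> uv /(jX uv)[x [y [xu yv xy]]]; exists x, y; rewrite xy orbT.
  have lnk1 k : k \in [set f i; f j] -> linked (@adj G) (X (inl k)) (X (edge_vertex (f i) (f j))).
    by move=> kij; rewrite ee; apply: lnk => //=; rewrite ve.
  apply: econU; [exact: adj_sym | | exact: cX |].
    by apply: econU; [exact: adj_sym | exact: cX.. |]; apply: lnk1; rewrite !inE eqxx.
  apply: linkedC; first exact: adj_sym.
  by apply: linkedW (lnk1 (f j) _); rewrite ?subsetUr // !inE eqxx orbT.
pose A i j := \bigcup_(g in D i j) rho g.
have /fin_all_exists[c cP] : forall i : 'I_5, exists x,
    exists2 g, g \in X (inl (f i)) & x \in rho g.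
  move=> i; have [/set0Pn[g gX] _] := cX (inl (f i)).
  have [/set0Pn[x xg] _] : econ (@grid_adj a b) (rho g).
    by apply: cr; apply/bigcupP; exists (inl (f i)).
  by exists x, g.
have disj u v x y : avoids p u -> avoids p v -> u != v -> ~~ adj u v ->
    x \in X u -> y \in X v -> [disjoint rho x & rho y].
  move=> au av uv nuv xu yv; have /andP[xy nxy] := model_anti uv nuv xu yv.
  apply: dr => //; [by apply/bigcupP; exists u | by apply/bigcupP; exists v |].
  apply/negP=> /andP[Nx Ny].
  by move: uv; rewrite (Nq u x au xu Nx) (Nq v y av yv Ny) eqxx.
have inl_neq i j : i != j -> (inl (f i) : subdiv (complete 6)) != inl (f j).
  by move=> ij; apply/negP=> /eqP[] /eqP; apply/negP/fI.
apply: (@no_K5_grid a b c A).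
- move=> i j ij; have [x xi cx] := cP i; have [y yj cy] := cP j.
  have d : [disjoint rho x & rho y].
    by apply: (disj (inl (f i)) (inl (f j))) => //; apply: inl_neq.
  by apply: contraTneq cx => ->; rewrite (disjointFl d cy).
- move=> i j; have [x xi cx] := cP i; have [y yj cy] := cP j => ltij.
  have ij : i != j by rewrite -val_eqE /=; lia.
  split.
  + by apply/bigcupP; exists x; rewrite // !inE xi.
  + by apply/bigcupP; exists y; rewrite // !inE yj !orbT.
  have [D0 connD] := cD i j ij.
  apply: (@econ_bigcup _ _ _ (@adj G)) => //.
    by move=> g gD; apply/cr/(subsetP (DU i j ij)).
  by move=> g g' gD gD'; apply: lr; apply: (subsetP (DU i j ij)).
- move=> i j k l ltij ltkl ik il jk jl.
  have ij : i != j by rewrite -val_eqE /=; lia.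
  have kl : k != l by rewrite -val_eqE /=; lia.
  apply/pred0P=> z /=; apply/negP=> /andP[/bigcupP[x xD zx] /bigcupP[y yD zy]].
  suff d : [disjoint rho x & rho y] by rewrite (disjointFr d zx) in zy.
  have [u [au xu eu]] := DP i j x ij xD; have [v [av yv ev]] := DP k l y kl yD.
  apply: (disj u v) => //.
    have [e1 ee1 ve1] := edge_vertexP (fI _ _ ij).
    have [e2 ee2 ve2] := edge_vertexP (fI _ _ kl).
    rewrite ee1 in eu; rewrite ee2 in ev.
    case: eu => [->|[]->]; case: ev => [->|[]->] //; try exact: inl_neq.
    apply/negP=> /eqP[/(congr1 val)]; rewrite ve1 ve2 => /setP/(_ (f i)).
    by rewrite !inE eqxx (negPf (fI _ _ ik)) (negPf (fI _ _ il)).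
  have [e1 ee1 ve1] := edge_vertexP (fI _ _ ij).
  have [e2 ee2 ve2] := edge_vertexP (fI _ _ kl).
  rewrite ee1 in eu; rewrite ee2 in ev.
  by case: eu => [->|[]->]; case: ev => [->|[]->] //=;
    rewrite ?ve1 ?ve2 !inE negb_or !fI // eq_sym.
Qed.

End Model.

Section CanvasFree.
Variables w m h P : nat.
Hypothesis wm : 2 * w < m.
Local Notation G := (canvas w m h P).

Definition cut_region a (g : G) :=
  match g with
  | inl z => cells (2 * m + 4 + m + 1) (6 * height h + 2) (own_pt w m h P a z.1 z.2)
  | inr k => cells (2 * m + 4 + m + 1) (6 * height h + 2) (own_col m a k.+1)
  end.

Lemma canvas_inS (z : 'I_(width w m) * 'I_(height h)) (g : G) :
  @adj G (inl z) g -> inS w m z.1 z.2.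
Proof. by case: g => [z'|k] /= => [/and3P[]|/touch_even]; rewrite /inS // => ->. Qed.

Lemma canvas_K6_free : ~ induced_minor (subdiv (complete 6)) G.
Proof.
move=> [X [cX dX jX]].
case: (pickP [pred vi : subdiv (complete 6) * 'I_m | inr vi.2 \in X vi.1]) => [[v i] /= iX|none].
  pose a := i.+1; have am : 0 < a <= m by rewrite /= ltn_ord.
  (* If the column vertex lies in the bag of a branch vertex [p], no bag avoiding [p] is adjacent to
     that bag, and [q := p] is a placeholder. If it lies in the bag of an edge [pq], dropping [p]
     leaves the bag of [q] as the only adjacent one. *)
  have [p [q [pv qv]]] : exists p q, ~~ avoids p v /\
      forall u, avoids p u -> adj u v -> u = inl q.
    case: (v) => [p|e].
      by exists p, p; rewrite /= eqxx; split=> // -[k|e] //= /negPf->.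
    have := valP e; rewrite inE => /existsP[p /existsP[q /andP[_ /eqP ve]]].
    exists p, q; rewrite /= ve !inE eqxx; split=> // -[k|e'] //= kp.
    by rewrite ve !inE (negPf kp) => /eqP->.
  have Ui g : g \in \bigcup_(u | avoids p u) X u -> g != inr i.
    move=> /bigcupP[u au gu]; apply: contraNneq pv => gi.
    by rewrite -(model_uniq dX (u := u) (v := v) (g := g)) // gi.
  have US z : inl z \in \bigcup_(u | avoids p u) X u -> inS w m z.1 z.2.
    move=> /bigcupP[u au gu]; have [g'] := model_neighbor cX jX gu.
    exact: canvas_inS.
  have ka (k : 'I_m) : inr k != inr i :> G -> k.+1 != a.
    by apply: contraNneq => -[/val_inj->].
  have bk (k : 'I_m) : 0 < k.+1 <= m by rewrite ltn_ord.
  apply: (@no_model G X cX dX jX _ _ (cut_region a) (fun g => adj g (inr i)) p q).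
  - case=> [z|k] gU; first by apply: (own_pt_econ _ wm am) => //; apply: US.
    exact: (own_col_econ _ wm am).
  - case=> [z|k] [z'|k'] gU gU' //= zz.
    + by have /and3P[S S' st] := zz; apply: link_step.
    + by apply: link_col => //; apply/ka/Ui.
    apply: linkedC; first exact: grid_adj_sym.
    by apply: link_col => //; apply/ka/Ui.
  - move=> g g' gU gU' gg ngg nN; apply/pred0P=> -[x y] /=; apply/negP=> /andP[].
    case: g g' gU gU' gg ngg nN => [z|k] [z'|k'] gU gU' gg ngg nN; rewrite /= !inE /= => o o'.
    + have [||||||[e1 e2]|] := own_pt_inj wm am _ _ _ _ _ _ o o' => //; try exact: US.
        case/eqP: gg; case: z z' e1 e2 {gU gU' ngg nN o o'} => [z1 z2] [z1' z2'] /=.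
        by move=> /val_inj-> /val_inj->.
      exact/negP.
    + case/negP: ngg.
      exact: (own_col_pt wm am (bk k') (ka k' (Ui _ gU')) (ltn_ord _) (ltn_ord _) (US z gU) o o').
    + case/negP: ngg.
      exact: (own_col_pt wm am (bk k) (ka k (Ui _ gU)) (ltn_ord _) (ltn_ord _) (US z' gU') o' o).
    + have [e] := own_col_inj (height h) wm am (bk k) (bk k') (ka k (Ui _ gU))
        (ka k' (Ui _ gU')) o o'.
      by case/eqP: gg; congr inr; apply: val_inj.
  - move=> u g au gu gi; apply: qv => //; apply/jX.
      by apply: contraNneq pv => <-.
    by exists g, (inr i).
have inlX v g : g \in X v -> exists z, g = inl z.
  by case: g => [z|i] gX; [exists z | have := none (v, i); rewrite /= gX].
(* Without column vertices in the bags the grid is its own drawing; [set0] is a default for column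
   vertices. *)
pose sng (g : G) : {set 'I_(width w m) * 'I_(height h)} :=
  if g is inl z then [set z] else set0.
apply: (@no_model G X cX dX jX _ _ sng pred0 ord0 ord0) => //.
- move=> g /bigcupP[u _ /inlX[z ->]]; exact: econ1.
- move=> g g' /bigcupP[u _ /inlX[z ->]] /bigcupP[u' _ /inlX[z' ->]] /and3P[_ _ zz].
  by exists z, z'; rewrite !inE !eqxx zz orbT.
move=> g g' /bigcupP[u _ /inlX[z ->]] /bigcupP[u' _ /inlX[z' ->]] zz _ _.
by rewrite disjoints1 inE; apply: contraNneq zz => ->.
Qed.

End CanvasFree.

(** * Regions *)

Section Regions.
Variables (G H : sgraph) (R : G -> subgraph H).
Hypotheses (cR : forall v, connected (R v))
  (RP : forall u v, u != v ->
     (adj u v <-> sub_vertices (R u) :&: sub_vertices (R v) != set0)).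
Local Notation rho v := (sub_vertices (R v)).
Local Notation con := (econ (@adj H)).
Local Notation lnk := (linked (@adj H)).

Lemma region_con v : con (rho v).
Proof.
have [R0 c] := cR v; split=> // x y xR yR.
apply: connect_sub (c x y xR yR) => a b ab; apply: connect1.
by have /andP[aR bR] := sub_adj_vertices ab; rewrite /restr aR bR (sub_adj_adj ab).
Qed.

Lemma region_linked u v : adj u v -> lnk (rho u) (rho v).
Proof.
move=> uv; have ne : u != v by apply: contraTneq uv => ->; rewrite adj_irrefl.
have /set0Pn[x] := (RP ne).1 uv; rewrite inE => /andP[xu xv].
by exists x, x; rewrite eqxx.
Qed.

Lemma region_disjoint u v : u != v -> ~~ adj u v -> [disjoint rho u & rho v].
Proof.
by move=> ne; apply: contraNT; rewrite -setI_eq0 => /(RP ne).2.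
Qed.

(* Follow a path inside the region of [v] from the region of [x] to the first
   region of another neighbour, and forget its part before the last visit to
   the region of [x]. *)
Lemma partner v x x0 : adj v x -> adj v x0 -> x != x0 ->
  (forall a b, adj v a -> adj v b -> ~~ adj a b) ->
  exists y W, [/\ adj v y, y != x, [/\ con W, W \subset rho v, lnk (rho x) W & lnk W (rho y)]
    & forall g, adj v g -> g != y -> [disjoint W & rho g]].
Proof.
move=> vx vx0 xx0 ind.
have dN a b : adj v a -> adj v b -> a != b -> [disjoint rho a & rho b].
  by move=> va vb ab; apply: region_disjoint => //; apply: ind.
have meet a : adj v a -> exists2 p, p \in rho v & p \in rho a.
  move=> va; have ne : v != a by apply: contraTneq va => ->; rewrite adj_irrefl.
  have /set0Pn[p] := (RP ne).1 va.
  by rewrite inE => /andP[]; exists p.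
have [p pv px] := meet x vx; have [q qv qx0] := meet x0 vx0.
have [_ c] := region_con v; have /connectP[s] := c p q pv qv.
(* Invariant along the path: the current vertex is in the region of [x], or in a piece [W] that
   starts at this region and has not yet met the region of any neighbour of [v]. *)
pose free W := [/\ con W, W \subset rho v, lnk (rho x) W &
  forall g, adj v g -> [disjoint W & rho g]].
suff main : forall s z, z \in rho x \/ (exists2 W, free W & z \in W) ->
    path (restr (@adj H) (rho v)) z s -> last z s \in rho x0 ->
    exists y W, [/\ adj v y, y != x, [/\ con W, W \subset rho v, lnk (rho x) W
      & lnk W (rho y)] & forall g, adj v g -> g != y -> [disjoint W & rho g]].
  by move=> ps ql; apply: (main s p) => //; [left | rewrite -ql].
move=> {s p px pv}; elim=> [|z2 s IH] z zst /=.
  move=> _ zx0; exfalso; case: zst => [zx|[W [_ _ _ dW] zW]].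
    by rewrite (disjointFr (dN x x0 vx vx0 xx0) zx) in zx0.
  by rewrite (disjointFr (dW x0 vx0) zW) in zx0.
move=> /andP[/and3P[zv z2v zz2] ps] l.
have [z2x|z2x] := boolP (z2 \in rho x); first by apply: (IH z2) => //; left.
have [W [cW sW lW dW] zW] : exists2 W, [/\ con W, W \subset rho v, lnk (rho x) W &
    forall g, adj v g -> z2 \notin rho g -> [disjoint W & rho g]] & z2 \in W.
  case: zst => [zx|[W [cW sW lW dW] zW]].
    exists [set z2]; last by rewrite inE.
    split; [exact: econ1 | by rewrite sub1set | by exists z, z2; rewrite inE zz2 orbT | ].
    by move=> g _ h; rewrite disjoints1.
  exists (z2 |: W); last by rewrite !inE eqxx.
  split.
  - apply: econ_add => //; first exact: adj_sym.
    by exists z, z2; rewrite inE eqxx zz2 orbT.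
  - by rewrite subUset sub1set z2v.
  - by apply: linkedW lW; rewrite ?subsetUr.
  by move=> g vg z2g; rewrite -setI_eq0 setIUl setU_eq0 !setI_eq0 disjoints1 z2g dW.
case: (pickP [pred y | adj v y && (z2 \in rho y)]) => [y /= /andP[vy z2y]|none].
  exists y, W; split=> //.
  - by apply: contraNneq z2x => <-.
  - by split=> //; exists z2, z2; rewrite eqxx.
  move=> g vg gy; apply: dW => //; apply/negP=> z2g.
  by rewrite (disjointFr (dN g y vg vy gy) z2g) in z2y.
apply: (IH z2) => //; right; exists W => //; split=> // g vg; apply: dW => //.
by have := none g; rewrite /= vg /= => ->.
Qed.

End Regions.

(** * Counting by fibres *)

Lemma card_fibers (A B : finType) (S : {set A}) (f : A -> B) K :
  (forall b, #|[set x in S | f x == b]| <= K) -> #|S| <= K * #|B|.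
Proof.
move=> fib; rewrite -sum1_card (partition_big f predT) //= mulnC -sum_nat_const.
apply: leq_sum => b _; rewrite sum1dep_card; exact: fib.
Qed.

Lemma pigeonhole_fiber (A B : finType) (f : A -> B) K :
  K * #|B| < #|A| -> exists b, K < #|[set x | f x == b]|.
Proof.
move=> lt; apply/existsP; apply: contraTT lt => /existsPn no.
rewrite -leqNgt -cardsT; apply: (card_fibers (f := f)) => b.
have := no b; rewrite -leqNgt; apply: leq_trans; apply: subset_leq_card.
by apply/subsetP=> x; rewrite !inE.
Qed.

Lemma injection_of_card (A : finType) (S : {set A}) K : K <= #|S| ->
  exists2 f : 'I_K -> A, injective f & forall k, f k \in S.
Proof.
move=> KS; exists (fun k => enum_val (widen_ord KS k)) => [i j|k].
  by move=> /enum_val_inj[/val_inj].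
exact: enum_valP.
Qed.

(** * Links between rows *)

Section Links.
Variables w m h P : nat.
Local Notation G := (canvas w m h P).
Local Notation L := (colL w m).
Local Notation R := (colR w m).
Local Notation W := (width w m).

(* The first component of a row is 0, 1, 2 for the rows left of [colL],
   between [colL] and [colR], and right of [colR]. *)
Definition row : finType := ('I_3 * 'I_h.+1)%type.

Definition rowX (k : nat) a :=
  if k == 0 then 2 * w + 1 + a else if k == 1 then R - a else R + 1 + a.

Definition label_pt (r : row) a : G := pt w m h P (rowX r.1 a) (2 * r.2).

(** Between [colL] and [colR] the column vertices have neighbours only in special rows. *)
Definition valid (r : row) := (r.1 == 1 :> nat) ==> (P %| r.2).

Lemma rowX_width k a : a <= m -> rowX k a < W.
Proof. by rewrite /rowX /width /colZ /colR /colL; case: ifP => _; last case: ifP => _; lia. Qed.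

Lemma row_height (r : row) : 2 * r.2 < height h.
Proof. by rewrite /height; have := ltn_ord r.2; lia. Qed.

Lemma special2 y : special P (2 * y) = (P %| y).
Proof. by rewrite /special dvdn_pmul2l. Qed.

Lemma rowX_inj k k' a : k < 3 -> k' < 3 -> 0 < a <= m -> rowX k a = rowX k' a -> k = k'.
Proof.
rewrite /rowX /colR /colL.
by case: k k' => [|[|[|//]]] [|[|[|//]]] //= _ _; lia.
Qed.

Lemma row_eq (r r' : row) : r.1 = r'.1 :> nat -> r.2 = r'.2 :> nat -> r = r'.
Proof. by case: r r' => [r1 r2] [r1' r2'] /= /val_inj-> /val_inj->. Qed.

Lemma label_pt_inj r r' a : 0 < a <= m -> label_pt r a = label_pt r' a -> r = r'.
Proof.
move=> /andP[a0 am] /pt_inj; rewrite !rowX_width ?row_height // => /(_ isT isT isT isT)[e1 e2].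
have k : r.1 = r'.1 :> nat by apply: (rowX_inj _ _ _ e1); rewrite ?ltn_ord ?a0.
by apply: row_eq => //; lia.
Qed.

Hypotheses (wm : 2 * w < m) (P0 : 0 < P).

Lemma label_pt_adj r (i : 'I_m) : valid r -> @adj G (inr i) (label_pt r i.+1).
Proof.
move=> v; rewrite adj_col_pt ?rowX_width ?row_height // /touch special2.
move: v; rewrite /valid /rowX; have := ltn_ord r.1; have := ltn_ord i.
case: (r.1 : nat) => [|[|[|//]]] //= im _ v; rewrite ?eqxx ?orbT ?andbT; try lia.
by rewrite v andbT subnK ?eqxx ?orbT ?andbT; rewrite /colR; lia.
Qed.

Lemma label_ptP (i : 'I_m) (g : G) : @adj G (inr i) g ->
  exists2 r, valid r & g = label_pt r i.+1.
Proof.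
case: g => // -[X Y] /= t; have eY := touch_even t.
have yh : Y./2 < h.+1 by have := ltn_ord Y; rewrite {2}/height; lia.
have go k (k3 : k < 3) : (X : nat) = rowX k i.+1 ->
    inl (X, Y) = label_pt (Ordinal k3, Ordinal yh) i.+1.
  move=> e; congr (inl (_, _)); apply: val_inj; rewrite /= inordK //.
  - by rewrite -e ltn_ord.
  - by lia.
  by rewrite /height; lia.
case/andP: t => _ /or3P[/eqP e|/eqP e|/andP[/eqP e s]].
- by exists (Ordinal (isT : 0 < 3), Ordinal yh); [|apply: go].
- by exists (Ordinal (isT : 2 < 3), Ordinal yh); [|apply: go].
exists (Ordinal (isT : 1 < 3), Ordinal yh); last by apply: go; rewrite /rowX /=; lia.
by rewrite /valid /= -special2; have -> : 2 * Y./2 = Y by lia.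
Qed.

Lemma column_independent (i : 'I_m) (a b : G) : @adj G (inr i) a -> @adj G (inr i) b -> ~~ adj a b.
Proof.
case: a b => [a|//] [b|//] /= ta tb.
by apply/negP=> /and3P[_ _]; apply/negP/(touch_same_label wm _ ta tb); rewrite ltn_ord.
Qed.

(** Starting at height [P] rather than 0 leaves room below the first special row for the paths that
    drift around it. *)
Definition special_row (s : nat) : row := (inord 1, inord (s.+1 * P)).

Lemma special_row1 s : (special_row s).1 = 1 :> nat.
Proof. by rewrite /= inordK. Qed.

Lemma special_row2 s : s.+1 * P <= h -> (special_row s).2 = s.+1 * P :> nat.
Proof. by move=> sh; rewrite /= inordK. Qed.

Lemma special_row_valid s : s.+1 * P <= h -> valid (special_row s).
Proof. by move=> sh; rewrite /valid special_row2 // dvdn_mull ?implybT. Qed.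

Variables (H : sgraph) (Rg : G -> subgraph H).
Hypotheses (cR : forall v, connected (Rg v))
  (RP : forall u v, u != v ->
     (adj u v <-> sub_vertices (Rg u) :&: sub_vertices (Rg v) != set0)).
Local Notation rho v := (sub_vertices (Rg v)).
Local Notation con := (econ (@adj H)).
Local Notation lnk := (linked (@adj H)).

(** Every label determines a map from special rows to partner rows, and the pigeonhole principle
    yields [K] labels with the same map [phi]. Only even labels are used, so that points of one row
    with different labels are never adjacent. *)
Lemma links N K J : N * P <= h -> K * #|{ffun 'I_N -> row}| < J -> 2 * J < m ->
  exists (phi : 'I_N -> row) (lab : 'I_K -> nat) (Wk : 'I_K -> 'I_N -> {set H}),
  [/\ injective lab /\ (forall k, [/\ 1 < lab k, lab k < m & ~~ odd (lab k)]),
      forall s, valid (phi s) /\ phi s != special_row s,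
      forall k s, [/\ con (Wk k s), lnk (rho (label_pt (special_row s) (lab k))) (Wk k s)
        & lnk (Wk k s) (rho (label_pt (phi s) (lab k)))],
      forall k s z, inl z != label_pt (phi s) (lab k) ->
        [disjoint Wk k s & rho (inl z)]
    & forall k k' s s', k != k' -> [disjoint Wk k s & Wk k' s']].
Proof.
move=> NPh KJ Jm.
have cm (j : 'I_J) : (2 * j).+1 < m by have := ltn_ord j; lia.
pose col j : 'I_m := Ordinal (cm j).
pose gc j : G := inr (col j).
have colE j : col j = (2 * j).+1 :> nat by [].
have sh (s : 'I_N) : s.+1 * P <= h.
  by apply: leq_trans NPh; rewrite leq_mul2r ltn_ord orbT.
pose good (j : 'I_J) (s : 'I_N) r (S : {set H}) :=
  [/\ valid r, r != special_row s, [/\ con S, S \subset rho ((gc j)),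
      lnk (rho (label_pt (special_row s) (col j).+1)) S
      & lnk S (rho (label_pt r (col j).+1))]
    & forall g, adj ((gc j)) g -> g != label_pt r (col j).+1 -> [disjoint S & rho g]].
have ex j s : exists rS, good j s rS.1 rS.2.
  have vs := special_row_valid (sh s).
  (* A second neighbour outside the middle, which [partner] needs so that the path leaves the
     starting region. *)
  pose r0 : row := (ord0, ord0).
  have v0 : valid r0 by [].
  have [|y [S [vy ys [c1 c2 c3 c4] d]]] := @partner G H Rg cR RP ((gc j)) _ _
    (label_pt_adj (col j) vs) (label_pt_adj (col j) v0) _ (@column_independent (col j)).
    apply/eqP=> /label_pt_inj; rewrite ltn_ord => /(_ isT).
    by move=> /(congr1 (fun r : row => (r.1 : nat))); rewrite special_row1.
  have [r vr yr] := label_ptP vy; rewrite yr in ys c4 d.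
  by exists (r, S); split=> //=; apply: contraNneq ys => ->.
have /fin_all_exists[f fP] : forall js : 'I_J * 'I_N, exists rS, good js.1 js.2 rS.1 rS.2.
  by case=> j s; apply: ex.
pose Phi j : {ffun 'I_N -> row} := [ffun s => (f (j, s)).1].
have [phi phiK] : exists b, K < #|[set j | Phi j == b]|.
  by apply: pigeonhole_fiber; rewrite card_ord.
have [c cI cP] := injection_of_card (ltnW phiK).
have phiE k s : (f (c k, s)).1 = phi s.
  by have := cP k; rewrite inE => /eqP <-; rewrite ffunE.
exists phi, (fun k => (col (c k)).+1), (fun k s => (f (c k, s)).2); split.
- split; first by move=> k k' /succn_inj e; apply/cI/val_inj; move: e => /=; rewrite -!multE; lia.
  move=> k; rewrite colE; split=> //.
    by have := ltn_ord (c k); lia.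
  by rewrite /= negbK mul2n odd_double.
- move=> s; case: (posnP K) => [K0|K0].
    have [j /eqP <-] : exists j, Phi j == phi.
      have /card_gt0P[j] : 0 < #|[set j | Phi j == phi]| by lia.
      by rewrite inE; exists j.
    by have [v ne _ _] := fP (j, s); rewrite ffunE.
  by have [v ne _ _] := fP (c (Ordinal K0), s); rewrite phiE in v ne.
- by move=> k s; have [_ _ [c1 _ c3 c4] _] := fP (c k, s); rewrite phiE in c4.
- move=> k s z zne; have [_ _ [_ c2 _ _] d] := fP (c k, s); rewrite phiE in d.
  have [a|na] := boolP (@adj G (gc (c k)) (inl z)); first exact: d.
  by apply: disjointWl c2 _; apply: (region_disjoint RP).
move=> k k' s s' kk; have [_ _ [_ c2 _ _] _] := fP (c k, s).
have [_ _ [_ c2' _ _] _] := fP (c k', s').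
apply: disjointWl c2 _; apply: disjointWr c2' _; apply: (region_disjoint RP) => //.
apply: contraNneq kk => -[e].
by apply/eqP/cI/val_inj; move: e => /=; rewrite -!multE; lia.
Qed.

End Links.

(** * Blocks of the grid *)

Definition lipschitz (g : nat -> nat) := forall y, g y <= g y.+1 + 1 /\ g y.+1 <= g y + 1.

(** This is the McShane extension, a maximum of cones of slope one centred at the prescribed points;
    truncation at 0 preserves the slope. *)
Lemma lipschitz_extension (J : finType) (z b : J -> nat) B :
  (forall k l, b k <= b l + ((z k - z l) + (z l - z k))) -> (forall k, b k <= B) ->
  exists g, [/\ lipschitz g, forall k, g (z k) = b k & forall y, g y <= B].
Proof.
move=> lip bB; pose F y k := b k - ((z k - y) + (y - z k)).
have sup y k : F y k <= \max_k F y k by apply: leq_bigmax.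
exists (fun y => \max_k F y k); split.
- by move=> y; split; apply/bigmax_leqP => k _; [have := sup y.+1 k | have := sup y k];
    rewrite /F; lia.
- move=> k; apply/eqP; rewrite eqn_leq; apply/andP; split.
    by apply/bigmax_leqP => l _; have := lip l k; rewrite /F; lia.
  by have := sup (z k) k; rewrite {1}/F; lia.
by move=> y; apply/bigmax_leqP => k _; have := bB k; rewrite /F; lia.
Qed.

Section Columns.
Variables w m : nat.

(** [colL] and [colR] get the numbers [w + 1] and [w + 2], so part [k] of a row lies between the
    columns numbered [w + k] and [w + k + 1]. *)
Definition grid_col c :=
  if c <= w then 2 * c else if c == w.+1 then colL w m else
  if c == w.+2 then colR w m else colZ w m + 2 * (c - w.+3).

Hypothesis m0 : 0 < m.

Lemma col_step c : grid_col c + 2 <= grid_col c.+1.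
Proof.
by rewrite /grid_col /colZ /colR /colL; repeat case: ifP => ?; lia.
Qed.

Lemma col_le a b : a <= b -> grid_col a <= grid_col b.
Proof.
move=> ab; rewrite -(subnKC ab); elim: (b - a) => [|n IH]; first by rewrite addn0.
by rewrite addnS; have := col_step (a + n); lia.
Qed.

Lemma col_lt a b : a < b -> grid_col a + 2 <= grid_col b.
Proof. by move=> /col_le; have := col_step a; lia. Qed.

Lemma col_width c : c <= 2 * w + 3 -> grid_col c < width w m.
Proof. by move=> /col_le; rewrite /width ltnS => /leq_trans; apply;
  rewrite /grid_col; repeat case: ifP; lia. Qed.

Lemma col_vertical c : c <= 2 * w + 3 -> vertical w m (grid_col c).
Proof.
move=> c2; rewrite /vertical /grid_col; case: ifP => h1; first by apply/or4P/Or41; lia.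
case: ifP => h2; first by rewrite eqxx orbT.
case: ifP => h3; first by rewrite eqxx !orbT.
by apply/or4P/Or44; lia.
Qed.

End Columns.

Section Blocks.
Variables (w m h P : nat) (Ev : finType).
Local Notation W := (width w m).
Local Notation Hh := (height h).
Definition gridpoint : finType := ('I_W * 'I_Hh)%type.
Variables (src dst : Ev -> gridpoint) (same : rel Ev).

Implicit Types (f g : nat -> nat -> bool) (k l r : nat -> nat).

(** The column vertices are replaced by the links found inside their regions. *)
Definition augmented : finType := (gridpoint + Ev)%type.

Definition aug_adj : rel augmented := fun x y =>
  match x, y with
  | inl p, inl q => [&& inS w m p.1 p.2, inS w m q.1 q.2 & grid_adj p q]
  | inl p, inr e | inr e, inl p => (p == src e) || (p == dst e)
  | inr _, inr _ => false
  end.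

(* Two links in the same column come from one region and may meet. *)
Definition aug_meet : rel augmented := fun x y =>
  match x, y with
  | inr e, inr e' => same e e'
  | _, _ => aug_adj x y
  end.

Lemma aug_adj_sym : symmetric aug_adj.
Proof. by case=> p [] q //=; rewrite grid_adj_sym andbCA. Qed.

Definition aug_pt X Y : augmented := inl (inord X : 'I_W, inord Y : 'I_Hh).

(** [f y] selects the points of row [y]. Between the rows [y] and [y + 1] only the column [k y] may
    be used, and only if both rows contain it. *)
Definition block (f : nat -> nat -> bool) (k : nat -> nat) : {set augmented} :=
  [set x : augmented | if x is inl p then
     f p.2./2 p.1 && (odd p.2 ==> (p.1 == k p.2./2 :> nat) && f p.2./2.+1 p.1) else false].

Lemma aug_meetC : symmetric same -> symmetric aug_meet.
Proof. by move=> ss [p|e] [p'|e'] //=; rewrite ?ss // grid_adj_sym andbCA. Qed.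

Lemma aug_adj_gp X Y X' Y' : X < W -> Y < Hh -> X' < W -> Y' < Hh ->
  aug_adj (aug_pt X Y) (aug_pt X' Y') = [&& inS w m X Y, inS w m X' Y' & step X Y X' Y'].
Proof. by move=> h1 h2 h3 h4; rewrite /= /grid_adj /= !inordK. Qed.

Lemma block_gp f k X y : X < W -> y <= h -> f y X -> aug_pt X (2 * y) \in block f k.
Proof.
move=> XW yh fyX; have yH : 2 * y < Hh by rewrite /height; lia.
by rewrite inE /= !inordK // mul2n doubleK odd_double fyX.
Qed.

Lemma blockP f k x : x \in block f k ->
  exists X Y, [/\ X < W, Y < Hh, x = aug_pt X Y, f Y./2 X & odd Y -> f Y./2.+1 X].
Proof.
rewrite inE; case: x => // -[X Y] /= /andP[fx o].
exists X, Y; split=> //; first by rewrite /aug_pt !inord_val.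
by move=> oY; move: o; rewrite oY => /andP[].
Qed.

Lemma gp_inj X Y X' Y' : X < W -> Y < Hh -> X' < W -> Y' < Hh ->
  aug_pt X Y = aug_pt X' Y' -> X = X' /\ Y = Y'.
Proof.
move=> h1 h2 h3 h4 [/(congr1 val)/= + /(congr1 val)/=].
by rewrite !inordK.
Qed.

(** Separation within the rows suffices, since a point at an odd level lies in a column selected in
    the rows below and above it. *)
Lemma block_anti f g k k' :
  (forall y X X', f y X -> g y X' -> X.+1 < X' \/ X'.+1 < X) ->
  anti aug_meet (block f k) (block g k').
Proof.
move=> sep x x' /blockP[X [Y [XW YH -> fX oX]]] /blockP[X' [Y' [XW' YH' -> gX oX']]].
have same_row : X.+1 < X' \/ X'.+1 < X -> Y = Y' ->
    (aug_pt X Y != aug_pt X' Y') && ~~ aug_meet (aug_pt X Y) (aug_pt X' Y').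
  move=> s YY; apply/andP; split; first by apply/eqP=> /gp_inj; case=> //; lia.
  by apply/negP; rewrite /aug_meet aug_adj_gp // => /and3P[_ _]; rewrite /step; lia.
have same_col y : f y X -> g y X' -> X != X'.
  by move=> a b; have := sep _ _ _ a b; lia.
have [YY|YY] := eqVneq Y Y'; first by apply: same_row => //; apply: sep fX _; rewrite YY.
apply/andP; split; first by apply/eqP=> /gp_inj; case=> //; lia.
apply/negP; rewrite /aug_meet aug_adj_gp // => /and3P[_ _].
rewrite /step (negPf YY) orbF => /andP[/eqP XX d].
suff [y [a b]] : exists y, f y X /\ g y X' by have := same_col y a b; rewrite XX eqxx.
have [oY|oY] := boolP (odd Y); have [oY'|oY'] := boolP (odd Y'); first lia; last lia.
  have [e|e] : Y'./2 = Y./2 \/ Y'./2 = Y./2.+1 by lia.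
    by exists Y./2; rewrite -{2}e.
  by exists Y./2.+1; rewrite -{2}e; split=> //; apply: oX.
have [e|e] : Y./2 = Y'./2 \/ Y./2 = Y'./2.+1 by lia.
  by exists Y./2; rewrite {2}e.
by exists Y./2; rewrite {2}e; split=> //; apply: oX'.
Qed.

Definition interval y0 y1 (l r : nat -> nat) y X := (y0 <= y <= y1) && (l y <= X <= r y).

Lemma inS_even X y : inS w m X (2 * y).
Proof. by rewrite /inS mul2n odd_double. Qed.

Lemma gp_eq (p : gridpoint) X Y : X < W -> Y < Hh ->
  (inl p == aug_pt X Y :> augmented) = (p.1 == X :> nat) && (p.2 == Y :> nat).
Proof.
case: p => Z T XW YH; apply/eqP/andP => [[-> ->]|[/eqP e /eqP e']] /=.
  by rewrite !inordK.
by congr (inl (_, _)); apply: val_inj; rewrite /= inordK.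
Qed.

Lemma econ_row y (l r : nat) k : y <= h -> l <= r -> r < W ->
  econ aug_adj (block (fun y' X => (y' == y) && (l <= X <= r)) k).
Proof.
move=> yh; have yH : 2 * y < Hh by rewrite /height; lia.
have one X : X < W ->
    block (fun y' Z => (y' == y) && (X <= Z <= X)) k = [set aug_pt X (2 * y)].
  move=> XW; apply/setP=> -[[Z Y]|e]; last by rewrite !inE.
  rewrite !inE gp_eq //=.
  by have [e|e] := boolP (odd Y); lia.
elim: r => [|r IH] lr rW; first by move: lr; rewrite leqn0 => /eqP->; rewrite one //; apply: econ1.
have [lr'|lr'] := ltnP l r.+1; last first.
  have e : l = r.+1 by apply/eqP; rewrite eqn_leq lr lr'.
  by rewrite e one //; apply: econ1.
have -> : block (fun y' X => (y' == y) && (l <= X <= r.+1)) k =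
    block (fun y' X => (y' == y) && (l <= X <= r)) k :|: [set aug_pt r.+1 (2 * y)].
  rewrite -one //; apply/setP=> -[[Z Y]|e]; last by rewrite !inE.
  rewrite !inE /=.
  by case: (Y./2 =P y) => // e; have [o|o] := boolP (odd Y); lia.
apply: econU; [exact: aug_adj_sym | by apply: IH; lia | exact: econ1 |].
exists (aug_pt r (2 * y)), (aug_pt r.+1 (2 * y)); rewrite inE eqxx; split=> //.
  by apply: block_gp; lia.
by rewrite aug_adj_gp ?inS_even /step; lia.
Qed.

Lemma econ_block y0 y1 l r k : y0 <= y1 <= h ->
  (forall y, y0 <= y <= y1 -> l y <= r y < W) ->
  (forall y, y0 <= y < y1 -> [/\ vertical w m (k y), l y <= k y <= r y
     & l y.+1 <= k y <= r y.+1]) ->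
  econ aug_adj (block (interval y0 y1 l r) k).
Proof.
have row1 y : block (interval y y l r) k =
    block (fun y' X => (y' == y) && (l y <= X <= r y)) k.
  apply/setP=> -[[X Y]|e]; last by rewrite !inE.
  rewrite !inE /interval /=.
  by case: (Y./2 =P y) => [->|e]; [have [o|o] := boolP (odd Y) |]; lia.
elim: y1 => [|y1 IH] yy lr kP.
  have /andP[l0 r0] : l 0 <= r 0 < W by apply: lr; lia.
  have -> : y0 = 0 by lia.
  by rewrite row1; apply: econ_row.
have lr1 : l y1.+1 <= r y1.+1 < W by apply: lr; lia.
have [e|ne] := eqVneq y0 y1.+1.
  by rewrite e row1; apply: econ_row; lia.
have k1 : [/\ vertical w m (k y1), l y1 <= k y1 <= r y1 & l y1.+1 <= k y1 <= r y1.+1].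
  by apply: kP; lia.
have [v1 k1a k1b] := k1.
have H1 : 2 * y1 < Hh by rewrite /height; lia.
have H2 : (2 * y1).+1 < Hh by rewrite /height; lia.
have H3 : 2 * y1.+1 < Hh by rewrite /height; lia.
have kW : k y1 < W by lia.
have -> : block (interval y0 y1.+1 l r) k =
    (block (interval y0 y1 l r) k :|: [set aug_pt (k y1) (2 * y1).+1])
      :|: block (interval y1.+1 y1.+1 l r) k.
  apply/setP=> -[[X Y]|e]; last by rewrite !inE.
  rewrite !inE gp_eq //= /interval.
  have := odd_double_half Y; case: (odd Y) => /= eY; last first.
    have -> : (Y == (2 * y1).+1 :> nat) = false by lia.
    by rewrite andbF orbF !andbT; case: (ltngtP Y./2 y1.+1) => [||->]; lia.
  case: (ltngtP Y./2 y1) => [c|c|c].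
  - have -> : (Y == (2 * y1).+1 :> nat) = false by lia.
    by lia.
  - have -> : (Y == (2 * y1).+1 :> nat) = false by lia.
    by lia.
  have -> : (Y == (2 * y1).+1 :> nat) by lia.
  rewrite c; case: eqVneq => [->|]; last by lia.
  by lia.
have st1 : linked aug_adj (block (interval y0 y1 l r) k) [set aug_pt (k y1) (2 * y1).+1].
  exists (aug_pt (k y1) (2 * y1)), (aug_pt (k y1) (2 * y1).+1); rewrite inE eqxx; split=> //.
    by apply: block_gp; rewrite /interval; lia.
  rewrite aug_adj_gp ?inS_even // /inS v1 orbT /= /step eqxx; lia.
have st2 : linked aug_adj [set aug_pt (k y1) (2 * y1).+1] (block (interval y1.+1 y1.+1 l r) k).
  exists (aug_pt (k y1) (2 * y1).+1), (aug_pt (k y1) (2 * y1.+1)); rewrite inE eqxx; split=> //.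
    by apply: block_gp; rewrite /interval; lia.
  rewrite aug_adj_gp ?inS_even // /inS v1 orbT /= /step eqxx; lia.
apply: econU; first exact: aug_adj_sym.
- apply: econU; [exact: aug_adj_sym | apply: IH | exact: econ1 | exact: st1].
  + by lia.
  + by move=> y yb; apply: lr; lia.
  by move=> y yb; apply: kP; lia.
- by rewrite row1; apply: econ_row; lia.
by apply: linkedW st2; rewrite ?subsetUr.
Qed.

End Blocks.

(** * Lanes and gaps *)

Lemma antiU (I : finType) (E : rel I) (A B C : {set I}) :
  anti E A C -> anti E B C -> anti E (A :|: B) C.
Proof. by move=> hA hB x y; rewrite inE => /orP[]; auto. Qed.

Lemma antiC (I : finType) (E : rel I) (A B : {set I}) :
  symmetric E -> anti E A B -> anti E B A.
Proof. by move=> s h x y xB yA; rewrite eq_sym s; apply: h. Qed.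

Section Lanes.
Variables (w m h : nat) (Ev : finType).
Variables (src dst : Ev -> gridpoint w m h) (same : rel Ev).
Hypothesis m0 : 0 < m.
Local Notation W := (width w m).
Local Notation Hh := (height h).
Local Notation aug := (augmented w m h Ev).
Local Notation adjA := (aug_adj src dst).
Local Notation meetA := (aug_meet src dst same).
Local Notation col := (grid_col w m).
Local Notation gp := (@aug_pt w m h Ev).
Local Notation block := (@block w m h Ev).
Variable g : nat -> nat.
Hypothesis gL : lipschitz g.

(* Lane [c] walks in row [y] from column [g y + 4 c] to column [g (y + 1) + 4 c]
   and then goes up; [gap c] is the strip between the lanes [c] and [c + 1]. *)
Definition lane_l c y := col (minn (g y) (g y.+1) + 4 * c).
Definition lane_r c y := col (maxn (g y) (g y.+1) + 4 * c).

Definition lane c : {set aug} :=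
  block (interval 0 h (lane_l c) (lane_r c)) (fun y => col (g y.+1 + 4 * c)).

(** The margins of two leave a free grid column beside each lane, in which [joint] is placed. *)
Definition gap c y0 y1 : {set aug} :=
  block (interval y0 y1 (fun y => lane_r c y + 2) (fun y => lane_l c.+1 y - 2))
    (fun y => col (g y.+1 + 4 * c + 2)).

Lemma lane_econ c : (forall y, g y + 4 * c <= 2 * w + 3) -> econ adjA (lane c).
Proof.
move=> gc; apply: econ_block; [by rewrite leqnn | move=> y _ | move=> y _].
  apply/andP; split; first by apply: col_le => //; lia.
  by apply: col_width => //; have := gc y; have := gc y.+1; lia.
split; first by apply: col_vertical; have := gc y.+1.
  by rewrite /lane_l /lane_r !col_le //; lia.
by rewrite /lane_l /lane_r !col_le //; lia.
Qed.

(** Lanes are four columns apart and drift by at most one per row, so a middle column stays strictly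
    between them in two consecutive rows; the gap climbs there. *)
Lemma lane_r2 c y : lane_r c y + 2 <= col (g y.+1 + 4 * c + 2).
Proof. by apply: col_lt => //; have [] := gL y; lia. Qed.

Lemma lane_l2 c y : col (g y.+1 + 4 * c + 2) + 2 <= lane_l c.+1 y.
Proof. by apply: col_lt => //; have [] := gL y; lia. Qed.

Lemma lane_r2' c y : lane_r c y.+1 + 2 <= col (g y.+1 + 4 * c + 2).
Proof. by apply: col_lt => //; have [] := gL y.+1; lia. Qed.

Lemma lane_l2' c y : col (g y.+1 + 4 * c + 2) + 2 <= lane_l c.+1 y.+1.
Proof. by apply: col_lt => //; have [] := gL y.+1; lia. Qed.

Lemma gap_econ c y0 y1 : y0 <= y1 <= h -> (forall y, g y + 4 * c + 4 <= 2 * w + 3) ->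
  econ adjA (gap c y0 y1).
Proof.
move=> yy gc; apply: econ_block => //; [move=> y _ | move=> y _].
  have := lane_r2 c y; have := lane_l2 c y.
  have : lane_l c.+1 y < W by apply: col_width => //; have := gc y; lia.
  by lia.
split; first by apply: col_vertical; have := gc y.+1; lia.
  by have := lane_r2 c y; have := lane_l2 c y; lia.
by have := lane_r2' c y; have := lane_l2' c y; lia.
Qed.

Lemma lane_lt c c' y : c < c' -> lane_r c y + 2 <= lane_l c' y.
Proof. by move=> cc; apply: col_lt => //; have [] := gL y; lia. Qed.

Lemma lane_lane c c' : c != c' -> anti meetA (lane c) (lane c').
Proof.
rewrite neq_ltn => /orP[] cc; apply: block_anti => y X X'; rewrite /interval;
  have := lane_lt y cc; lia.
Qed.

Lemma lane_gap c c' y0 y1 : anti meetA (lane c) (gap c' y0 y1).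
Proof.
apply: block_anti => y X X'; rewrite /interval; have [cc|cc] := leqP c c'.
  have [->|/(lane_lt y)] : c = c' \/ c < c' by lia.
    by lia.
  have : lane_l c' y <= lane_r c' y by apply: col_le => //; lia.
  by lia.
have [->|/(lane_lt y)] : c = c'.+1 \/ c'.+1 < c by lia.
  by lia.
have : lane_l c'.+1 y <= lane_r c'.+1 y by apply: col_le => //; lia.
by lia.
Qed.

Lemma gap_gap c c' y0 y1 y0' y1' : (y1 < y0') || (y1' < y0) -> anti meetA (gap c y0 y1) (gap c' y0' y1').
Proof. by move=> yy; apply: block_anti => y X X'; rewrite /interval; lia. Qed.

Lemma rowX_between k a : k < 3 -> 1 < a < m ->
  col (w + k) + 2 <= rowX w m k a /\ rowX w m k a + 2 <= col (w + k).+1.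
Proof.
rewrite /rowX /grid_col /colZ /colR /colL.
by case: k => [|[|[|//]]] _ am /=; repeat case: ifP => ?; lia.
Qed.

Lemma rowX_lt k a : k < 3 -> 1 < a < m -> rowX w m k a < W.
Proof. by move=> _ am; apply: rowX_width; lia. Qed.

(** A lane that drifts from column [w + k] to the next one sweeps over all label points of part
    [k]. *)
Lemma lane_row c k a y : k < 3 -> 1 < a < m -> y <= h ->
  g y + 4 * c = w + k -> g y.+1 = (g y).+1 -> gp (rowX w m k a) (2 * y) \in lane c.
Proof.
move=> k3 am yh gy gy1; apply: block_gp => //; first exact: rowX_lt.
rewrite /interval /lane_l /lane_r gy1 /=.
have -> : minn (g y) (g y).+1 + 4 * c = w + k by lia.
have -> : maxn (g y) (g y).+1 + 4 * c = (w + k).+1 by lia.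
by have [] := rowX_between k3 am; lia.
Qed.

(** When lane [c + 1] stands straight at column [w + k + 1], part [k] lies in the gap before it; in
    [gap_right] lane [c] stands at column [w + k] and part [k] lies in the gap after it. *)
Lemma gap_left c k a y y0 y1 : k < 3 -> 1 < a < m -> y0 <= y <= y1 -> y <= h ->
  g y + 4 * c + 3 = w + k -> g y.+1 = g y -> gp (rowX w m k a) (2 * y) \in gap c y0 y1.
Proof.
move=> k3 am yy yh gy gy1; apply: block_gp => //; first exact: rowX_lt.
rewrite /interval /lane_l /lane_r gy1 minnn maxnn yy /=.
have -> : g y + 4 * c.+1 = (w + k).+1 by lia.
have : col (g y + 4 * c) <= col (w + k) by apply: col_le => //; lia.
by have [] := rowX_between k3 am; lia.
Qed.

Lemma gap_right c k a y y0 y1 : k < 3 -> 1 < a < m -> y0 <= y <= y1 -> y <= h ->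
  g y + 4 * c = w + k -> g y.+1 = g y -> gp (rowX w m k a) (2 * y) \in gap c y0 y1.
Proof.
move=> k3 am yy yh gy gy1; apply: block_gp => //; first exact: rowX_lt.
rewrite /interval /lane_l /lane_r gy1 minnn maxnn yy /= gy.
have : col (w + k).+1 <= col (g y + 4 * c.+1) by apply: col_le => //; lia.
by have [] := rowX_between k3 am; lia.
Qed.

(** A single point that connects lane [c] with the gap on its left, used as a connector of the
    minor. *)
Definition joint c y : aug := gp (col (g y + 4 * c) - 1) (2 * y).

Section Joint.
Variables c y : nat.
Hypotheses (yh : y <= h) (gy1 : g y.+1 = g y) (gc : 0 < g y + 4 * c <= 2 * w + 3).

Lemma joint_block k : [set joint c y] =
  block (fun y' X => (y' == y) && (X == col (g y + 4 * c) - 1)) k.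
Proof.
have yH : 2 * y < Hh by rewrite /height; lia.
have XW : col (g y + 4 * c) - 1 < W by have /andP[_ /(col_width m0)] := gc; lia.
apply/setP=> -[[Z Y]|e]; last by rewrite !inE.
rewrite !inE gp_eq //=.
by have [e|e] := boolP (odd Y); lia.
Qed.

Lemma joint_lane : exists2 x, x \in lane c & adjA x (joint c y).
Proof.
have yH : 2 * y < Hh by rewrite /height; lia.
have /andP[c0 /(col_width m0) XW] := gc.
exists (gp (col (g y + 4 * c)) (2 * y)).
  by apply: block_gp => //; rewrite /interval /lane_l /lane_r gy1 minnn maxnn leq0n yh !leqnn.
have : col 0 + 2 <= col (g y + 4 * c) by apply: col_lt.
by rewrite aug_adj_gp ?inS_even /step; lia.
Qed.

Lemma joint_gap c' y0 y1 : c = c'.+1 -> y0 <= y <= y1 -> 3 < g y + 4 * c ->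
  exists2 x, x \in gap c' y0 y1 & adjA (joint c y) x.
Proof.
move=> cc yy g4; have yH : 2 * y < Hh by rewrite /height; lia.
have /andP[c0 /(col_width m0) XW] := gc.
have c2 : col (g y + 4 * c') + 2 <= col (g y + 4 * c).-1 by apply: col_lt => //; lia.
have c3 : col (g y + 4 * c).-1 + 2 <= col (g y + 4 * c) by apply: col_lt => //; lia.
exists (gp (col (g y + 4 * c) - 2) (2 * y)).
  apply: block_gp => //; first by lia.
  by rewrite /interval /lane_l /lane_r gy1 minnn maxnn yy -cc; lia.
by rewrite aug_adj_gp ?inS_even /step; lia.
Qed.

Lemma joint_anti_lane c' : c' != c -> anti meetA [set joint c y] (lane c').
Proof.
move=> cc; rewrite (joint_block id); apply: block_anti => y' X X'.
move=> /andP[/eqP-> /eqP->]; rewrite /interval /lane_l /lane_r gy1 minnn maxnn => /andP[_].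
have [c1|c1|e] := ltngtP c' c; last by rewrite e eqxx in cc.
  have c2 : col (g y + 4 * c') + 2 <= col (g y + 4 * c).-1 by apply: col_lt => //; lia.
  have c3 : col (g y + 4 * c).-1 + 2 <= col (g y + 4 * c) by apply: col_lt => //; lia.
  by lia.
have : col (g y + 4 * c) + 2 <= col (g y + 4 * c') by apply: col_lt => //; lia.
by lia.
Qed.

Lemma joint_anti_gap c' y0 y1 : (y < y0) || (y1 < y) ->
  anti meetA [set joint c y] (gap c' y0 y1).
Proof.
move=> yy; rewrite (joint_block id); apply: block_anti => y' X X'.
by move=> /andP[/eqP-> /eqP->]; rewrite /interval; lia.
Qed.

Lemma joint_notin_gap c' y0 y1 : joint c y \notin gap c' y0 y1.
Proof.
have yH : 2 * y < Hh by rewrite /height; lia.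
have /andP[c0 /(col_width m0) XW] := gc.
have X1 : col (g y + 4 * c) - 1 < W by lia.
rewrite inE /joint /aug_pt !inordK //= mul2n doubleK odd_double andbT /interval /lane_l /lane_r gy1 minnn maxnn.
have [c1|c1] := leqP c c'.
  have : col (g y + 4 * c) <= col (g y + 4 * c') by apply: col_le => //; lia.
  by lia.
have : col (g y + 4 * c'.+1) <= col (g y + 4 * c) by apply: col_le => //; lia.
by lia.
Qed.

End Joint.

Lemma joint_anti c c' y y' : y <= h -> y' <= h -> g y.+1 = g y -> g y'.+1 = g y' ->
  0 < g y + 4 * c <= 2 * w + 3 -> 0 < g y' + 4 * c' <= 2 * w + 3 -> y != y' ->
  anti meetA [set joint c y] [set joint c' y'].
Proof.
move=> yh yh' gy gy' gc gc' yy.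
rewrite (joint_block yh gy gc id) (joint_block yh' gy' gc' id); apply: block_anti => z X X'.
by move=> /andP[/eqP-> _] /andP[e _]; rewrite e in yy.
Qed.

End Lanes.

(** * Links that jump over a column *)

Section Near.
Variables (w m h t D P : nat) (Ev : finType).
Variables (src dst : Ev -> gridpoint w m h) (same : rel Ev).
Hypothesis m0 : 0 < m.
Local Notation aug := (augmented w m h Ev).
Local Notation adjA := (aug_adj src dst).
Local Notation meetA := (aug_meet src dst same).
Local Notation gp := (@aug_pt w m h Ev).
Hypotheses (t0 : 0 < t) (tw : 8 * t <= w) (tD : 8 * t + 8 <= D) (DP : 4 * D <= P).
(** Link [n] jumps over the column numbered [w + kr n], from row [yl n] on its left to row [yr n] on
    its right; both rows are near the special row [Y n]. *)
Variables (Y yl yr kr lab : nat -> nat) (ev : nat -> Ev).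
Local Notation q := (t * t).
Local Notation vx n := (inr (ev n) : aug).
Hypotheses (YP : forall n n', n < n' < q -> Y n + P <= Y n')
  (Yh : forall n, n < q -> D <= Y n /\ Y n + D <= h)
  (ylY : forall n, n < q -> Y n < yl n + D /\ yl n < Y n + D)
  (yrY : forall n, n < q -> Y n < yr n + D /\ yr n < Y n + D)
  (kr2 : forall n, n < q -> 0 < kr n < 3)
  (labm : forall n, n < q -> 1 < lab n < m)
  (evl : forall n, n < q -> adjA (gp (rowX w m (kr n).-1 (lab n)) (2 * yl n)) (vx n))
  (evr : forall n, n < q -> adjA (gp (rowX w m (kr n) (lab n)) (2 * yr n)) (vx n))
  (evP : forall n x, n < q -> adjA x (vx n) ->
     x = gp (rowX w m (kr n).-1 (lab n)) (2 * yl n) \/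
     x = gp (rowX w m (kr n) (lab n)) (2 * yr n))
  (evS : forall n n', n < q -> n' < q -> n != n' ->
     ev n != ev n' /\ ~~ same (ev n) (ev n')).

Lemma index_lt j i : j < t -> i < t -> j * t + i < q.
Proof.
move=> jt it; apply: (@leq_trans (j.+1 * t)); last by rewrite leq_mul2r jt orbT.
by rewrite mulSn addnC ltn_add2r.
Qed.

(** Lane [n mod t + 1] is steered onto the column over which link [n] jumps and kept straight in
    both rows of the link. The distance [P >= 4 * D] of the special rows leaves enough rows for the
    drift in between. *)
Lemma near_lanes : exists g, [/\ lipschitz g, forall y, g y <= w + 2 &
  forall n, n < q -> forall y, (y == yl n) || (y == yr n) ->
    g y.+1 = g y /\ g y + 4 * (n %% t).+1 = w + kr n].
Proof.
pose z (k : 'I_q * bool * bool) := (if k.1.2 then yl k.1.1 else yr k.1.1) + k.2.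
pose b (k : 'I_q * bool * bool) := w + kr k.1.1 - 4 * (k.1.1 %% t).+1.
have modt n : n %% t < t by rewrite ltn_mod.
have [||g [gL gz gB]] := @lipschitz_extension _ z b (w + 2).
- move=> [[n b1] b2] [[n' b1'] b2']; rewrite /b /z /=.
  have := kr2 (ltn_ord n); have := kr2 (ltn_ord n'); have := modt n; have := modt n'.
  have ln := ylY (ltn_ord n); have rn := yrY (ltn_ord n).
  have ln' := ylY (ltn_ord n'); have rn' := yrY (ltn_ord n').
  have Z : Y n < (if b1 then yl n else yr n) + D /\ (if b1 then yl n else yr n) < Y n + D.
    by case: b1.
  have Z' : Y n' < (if b1' then yl n' else yr n') + D /\
    (if b1' then yl n' else yr n') < Y n' + D by case: b1'.
  have hb : b2 <= 1 by case: b2.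
  have hb' : b2' <= 1 by case: b2'.
  have [nn|nn|nn] := ltngtP n n'; last by rewrite nn; lia.
    by have := @YP n n'; rewrite nn ltn_ord => /(_ isT); lia.
  by have := @YP n' n; rewrite nn ltn_ord => /(_ isT); lia.
- by move=> [[n b1] b2]; rewrite /b /=; have := kr2 (ltn_ord n); lia.
exists g; split=> // n nq y yy.
have gE (b1 b2 : bool) : g ((if b1 then yl n else yr n) + b2) = w + kr n - 4 * (n %% t).+1.
  by have := gz (Ordinal nq, b1, b2); rewrite /z /b.
have b0 : exists b1 : bool, y = if b1 then yl n else yr n.
  by case/orP: yy => /eqP->; [exists true | exists false].
have [b1 e] := b0; have := gE b1 false; have := gE b1 true; rewrite -e addn0 addn1.
by move=> -> ->; have := modt n; have := kr2 nq; lia.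
Qed.

Section Route.
Variable g : nat -> nat.
Hypotheses (gL : lipschitz g) (gB : forall y, g y <= w + 2)
  (gE : forall n, n < q -> forall y, (y == yl n) || (y == yr n) ->
    g y.+1 = g y /\ g y + 4 * (n %% t).+1 = w + kr n).
Local Notation lane := (@lane w m h Ev g).
Local Notation gap := (@gap w m h Ev g).
Local Notation joint := (@joint w m h Ev g).

(* Thread [j] crosses the lanes [1, ..., t] one after the other, by the links
   [j * t, ..., j * t + t - 1], in rows that lie below those of thread [j + 1]. *)
Definition piece j i :=
  gap i (Y (j * t + i.-1) - D) (Y (j * t + minn i t.-1) + D).

Fixpoint thread j n : {set aug} :=
  if n is n'.+1 then thread j n' :|: (vx (j * t + n') |: piece j n'.+1) else piece j 0.

Lemma threadP j n x : x \in thread j n ->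
  (exists2 i, i <= n & x \in piece j i) \/ (exists2 i, i < n & x = vx (j * t + i)).
Proof.
elim: n => [|n IH] /=; first by left; exists 0.
rewrite !in_setU in_set1 => /or3P[/IH[[i ni xi]|[i ni xi]]|/eqP xi|xi].
- by left; exists i => //; lia.
- by right; exists i => //; lia.
- by right; exists n.
by left; exists n.+1.
Qed.

Lemma piece_thread j i n : i <= n -> piece j i \subset thread j n.
Proof.
elim: n => [|n IH] /=; first by rewrite leqn0 => /eqP->.
rewrite leq_eqVlt => /orP[/eqP->|lt]; first by rewrite setUA subsetUr.
by apply: subset_trans (IH _) (subsetUl _ _); lia.
Qed.

Lemma Y_le n n' : n <= n' -> n' < q -> Y n <= Y n'.
Proof. by rewrite leq_eqVlt => /orP[/eqP->//|lt] nq; have := @YP n n'; rewrite lt nq => /(_ isT); lia. Qed.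

Lemma index_mod j i : i < t -> (j * t + i) %% t = i.
Proof. by move=> it; rewrite modnMDl modn_small. Qed.

Lemma left_end j i : j < t -> i < t ->
  gp (rowX w m (kr (j * t + i)).-1 (lab (j * t + i))) (2 * yl (j * t + i)) \in piece j i.
Proof.
move=> jt it; have nq := index_lt jt it.
have [g1 g2] := gE nq (y := yl (j * t + i)) ltac:(by rewrite eqxx).
rewrite index_mod // in g2; have k3 := kr2 nq; have := Yh nq; have := ylY nq => yY Yh0.
have Yl : Y (j * t + i.-1) <= Y (j * t + i) by apply: Y_le => //; lia.
rewrite /piece; have -> : minn i t.-1 = i by lia.
by apply: gap_left => //; [lia | exact: labm | lia..].
Qed.

Lemma right_end j i : j < t -> i < t ->
  gp (rowX w m (kr (j * t + i)) (lab (j * t + i))) (2 * yr (j * t + i)) \in piece j i.+1.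
Proof.
move=> jt it; have nq := index_lt jt it.
have [g1 g2] := gE nq (y := yr (j * t + i)) ltac:(by rewrite eqxx orbT).
rewrite index_mod // in g2; have k3 := kr2 nq; have := Yh nq; have := yrY nq => yY Yh0.
have Yl : Y (j * t + i) <= Y (j * t + minn i.+1 t.-1).
  by apply: Y_le; [lia | apply: index_lt; lia].
by apply: gap_right => //; [lia | exact: labm | rewrite /=; lia | lia..].
Qed.

Lemma vx_end j i x : j < t -> i < t -> adjA x (vx (j * t + i)) ->
  x \in piece j i \/ x \in piece j i.+1.
Proof.
move=> jt it /(evP (index_lt jt it))[->|->]; [left | right]; [exact: left_end | exact: right_end].
Qed.

Lemma piece_econ j i : j < t -> i <= t -> econ adjA (piece j i).
Proof.
move=> jt it; have nq : j * t + minn i t.-1 < q by apply: index_lt; lia.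
have := Yh nq; have : Y (j * t + i.-1) <= Y (j * t + minn i t.-1).
  by apply: Y_le => //; lia.
by move=> YY Yh0; apply: gap_econ => //; [lia | move=> y; have := gB y; lia].
Qed.

Lemma thread_econ j n : j < t -> n <= t -> econ adjA (thread j n).
Proof.
move=> jt; elim: n => [|n IH] nt /=; first exact: piece_econ.
have symA := @aug_adj_sym w m h Ev src dst.
apply: econU => //; first by apply: IH; lia.
  apply: econ_add => //; first exact: piece_econ.
  exists (gp (rowX w m (kr (j * t + n)) (lab (j * t + n))) (2 * yr (j * t + n))), (vx (j * t + n)).
  by rewrite in_set1 eqxx right_end // evr ?orbT ?index_lt.
exists (gp (rowX w m (kr (j * t + n)).-1 (lab (j * t + n))) (2 * yl (j * t + n))), (vx (j * t + n)).
rewrite !in_setU in_set1 eqxx evl ?orbT ?index_lt //; split=> //.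
by apply: (subsetP (piece_thread j (leqnn n))); apply: left_end.
Qed.

Lemma lane_thread c j n : j < t -> n <= t -> anti meetA (lane c) (thread j n).
Proof.
move=> jt nt x y xl /threadP[[i it yi]|[i it ->]].
  exact: (lane_gap src dst same m0 gL xl yi).
case: x xl => [p|e] pl; last by rewrite inE in pl.
apply/andP; split=> //; apply/negP => /(vx_end jt) [|xi|xi]; first by lia.
  by have /andP[/eqP] := lane_gap src dst same m0 gL pl xi.
by have /andP[/eqP] := lane_gap src dst same m0 gL pl xi.
Qed.

Lemma piece_lt j j' i i' : j < j' -> j' < t -> i <= t -> i' <= t ->
  Y (j * t + minn i t.-1) + D < Y (j' * t + i'.-1) - D.
Proof.
move=> jj jt it it'.
have n1 : j' * t + i'.-1 < q by apply: index_lt; lia.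
have n2 : j * t + minn i t.-1 < j' * t + i'.-1.
  by have : j.+1 * t <= j' * t by [rewrite leq_mul2r jj orbT]; rewrite mulSn; lia.
by have := @YP _ _ (introT andP (conj n2 n1)); lia.
Qed.

Lemma piece_piece j j' i i' : j != j' -> j < t -> j' < t -> i <= t -> i' <= t ->
  anti meetA (piece j i) (piece j' i').
Proof.
rewrite neq_ltn => /orP[] jj jt jt' it it'.
  by apply: gap_gap => //; apply/orP; left; apply: piece_lt.
by apply: gap_gap => //; apply/orP; right; apply: piece_lt.
Qed.

Lemma thread_thread j j' : symmetric same -> j != j' -> j < t -> j' < t ->
  anti meetA (thread j t) (thread j' t).
Proof.
move=> ss jj jt jt' x y.
have end_anti k i k' i' e : k != k' -> k < t -> k' < t -> i <= t -> i' < t ->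
    e \in piece k i -> (e != vx (k' * t + i')) && ~~ meetA e (vx (k' * t + i')).
  move=> kk kt kt' it it'; case: e => [p|e] ek; last by rewrite inE in ek.
  apply/andP; split=> //; apply/negP => /(vx_end kt' it') [] h'.
    by have /andP[/eqP] := piece_piece kk kt kt' it (ltnW it') ek h'.
  by have /andP[/eqP] := piece_piece kk kt kt' it it' ek h'.
move=> /threadP[[i it xi]|[i it ->]] /threadP[[i' it' yi]|[i' it' ->]].
- exact: piece_piece xi yi.
- exact: end_anti xi.
- rewrite eq_sym (aug_meetC src dst ss); apply: end_anti yi => //; by rewrite eq_sym.
have [|e1 e2] := evS (index_lt jt it) (index_lt jt' it').
  apply: contraNneq jj => e.
  have : (j * t + i) %/ t = (j' * t + i') %/ t by rewrite e.
  by rewrite !divnMDl // !divn_small // !addn0 => ->.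
by apply/andP; split=> //; apply: contraNneq e1 => -[].
Qed.

Lemma joint_facts j i : j < t -> i < t -> let n := j * t + i in
  [/\ yl n <= h, g (yl n).+1 = g (yl n), 0 < g (yl n) + 4 * i.+1 <= 2 * w + 3
    & 3 < g (yl n) + 4 * i.+1].
Proof.
move=> jt it; have nq := index_lt jt it.
have [g1 g2] := gE nq (y := yl (j * t + i)) ltac:(by rewrite eqxx).
rewrite index_mod // in g2; have k3 := kr2 nq; have := Yh nq; have := ylY nq => yY Yh0 /=.
by split=> //; lia.
Qed.

Lemma joint_thread j i k : j < t -> i < t -> k < t -> k != j ->
  anti meetA [set joint i.+1 (yl (j * t + i))] (thread k t).
Proof.
move=> jt it kt kj; have nq := index_lt jt it; have [yh g1 gc _] := joint_facts jt it.
move=> x y; rewrite in_set1 => /eqP-> /threadP[[i' it' yi]|[i' it' ->]]; last first.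
  apply/andP; split=> //; apply/negP => /(vx_end kt it') [] h'.
    by have := joint_notin_gap Ev m0 yh g1 gc i' (Y (k * t + i'.-1) - D)
      (Y (k * t + minn i' t.-1) + D); rewrite -/(piece k i') h'.
  by have := joint_notin_gap Ev m0 yh g1 gc i'.+1 (Y (k * t + i'.+1.-1) - D)
      (Y (k * t + minn i'.+1 t.-1) + D); rewrite -/(piece k i'.+1) h'.
have [y1 y2] := ylY nq; have [Y1 Y2] := Yh nq.
apply: (joint_anti_gap src dst same m0 yh g1 gc _ (set11 _) yi).
have n1 : k * t + i'.-1 < q by apply: index_lt; lia.
have n2 : k * t + minn i' t.-1 < q by apply: index_lt; lia.
move: kj; rewrite neq_ltn => /orP[] kj; apply/orP; [right | left].
  have : (k * t + minn i' t.-1) < j * t + i.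
    by have : k.+1 * t <= j * t by [rewrite leq_mul2r kj orbT]; rewrite mulSn; lia.
  by move=> nn; have := @YP _ _ (introT andP (conj nn nq)); lia.
have : j * t + i < k * t + i'.-1.
  by have : j.+1 * t <= k * t by [rewrite leq_mul2r kj orbT]; rewrite mulSn; lia.
by move=> nn; have := @YP _ _ (introT andP (conj nn n1)); lia.
Qed.

(** Every lane meets every thread at a joint. Bag [i] unites lane [i + 1], thread [i] and their
    joint; the joint of lane [i + 1] and thread [j] connects the bags [i] and [j]. *)
Lemma near_minor_route (H : sgraph) (F : aug -> {set H}) : symmetric same ->
  (forall x, econ (@adj H) (F x)) ->
  (forall x y, adjA x y -> linked (@adj H) (F x) (F y)) ->
  (forall x y, x != y -> ~~ meetA x y -> [disjoint F x & F y]) -> minor (complete t) H.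
Proof.
move=> ss cF lF dF.
have symA := @aug_adj_sym w m h Ev src dst; have symM := aug_meetC src dst ss.
pose jt (i j : 'I_t) := joint i.+1 (yl (j * t + i)).
have fact (i j : 'I_t) := joint_facts (ltn_ord j) (ltn_ord i).
have jl (i j : 'I_t) : exists2 x, x \in lane i.+1 & adjA x (jt i j).
  by have [yh g1 gc _] := fact i j; apply: joint_lane.
have jth (i j : 'I_t) : exists2 x, x \in thread j t & adjA (jt i j) x.
  have [yh g1 gc g4] := fact i j; have nq := index_lt (ltn_ord j) (ltn_ord i).
  have := Yh nq; have := ylY nq => yY Yh0.
  have [|x xp ax] := @joint_gap w m h Ev src dst m0 g i.+1 (yl (j * t + i)) yh g1 gc i
    (Y (j * t + i.-1) - D) (Y (j * t + minn i t.-1) + D) (erefl _) _ g4.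
    have : Y (j * t + i.-1) <= Y (j * t + i) by apply: Y_le => //; lia.
    by have -> : minn i t.-1 = i by [have := ltn_ord i; lia]; lia.
  exists x => //; apply: (subsetP (piece_thread j (i := i) _)) => //; exact: ltnW.
have jlane (i j k : 'I_t) : k != i -> anti meetA [set jt i j] (lane k.+1).
  by have [yh g1 gc _] := fact i j; move=> ki; apply: joint_anti_lane.
have jthread (i j k : 'I_t) : k != j -> anti meetA [set jt i j] (thread k t).
  by move=> kj; apply: joint_thread => //; apply: ltn_ord.
have jj (i j k l : 'I_t) : i != k -> anti meetA [set jt i j] [set jt k l].
  move=> ik; have [yh g1 gc _] := fact i j; have [yh' g1' gc' _] := fact k l.
  apply: joint_anti => //.
  have nq := index_lt (ltn_ord j) (ltn_ord i); have nq' := index_lt (ltn_ord l) (ltn_ord k).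
  have := ylY nq; have := ylY nq'; have := Yh nq; have := Yh nq'.
  have [e|e|e] := ltngtP (j * t + i) (l * t + k).
  - by have := @YP _ _ (introT andP (conj e nq')); lia.
  - by have := @YP _ _ (introT andP (conj e nq)); lia.
  case/eqP: ik; apply: val_inj => /=.
  by rewrite -(index_mod j (ltn_ord i)) -(index_mod l (ltn_ord k)) e.
apply: (@minor_complete_regions H aug adjA meetA F cF lF dF t
  (fun i => jt i i |: (lane i.+1 :|: thread i t)) jt).
- move=> i; have cl : econ adjA (lane i.+1).
    by apply: lane_econ => // y; have := gB y; have := ltn_ord i; lia.
  have ct := thread_econ (ltn_ord i) (leqnn t).
  have [x xl ax] := jl i i; have [y yt ay] := jth i i.
  rewrite setUA; apply: econU => //.
    by apply: econ_add => //; exists x, (jt i i); rewrite in_set1 eqxx ax orbT.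
  by exists (jt i i), y; rewrite in_setU1 eqxx ay orbT.
- move=> i j ij; have ji : j != i by rewrite eq_sym.
  have mm : anti meetA (lane i.+1 :|: thread i t) (jt j j |: (lane j.+1 :|: thread j t)).
    have lt (k l : 'I_t) := @lane_thread k.+1 l t (ltn_ord l) (leqnn t).
    apply: antiC => //; rewrite setUA; apply: antiU; last first.
      apply: antiC => //; apply: antiU; first exact: lt.
      by apply: thread_thread => //; apply: ltn_ord.
    apply: antiC => //; apply: antiU; apply: antiC => //; apply: antiU.
    + exact: jlane.
    + by apply: lane_lane => //; rewrite eqSS.
    + exact: jthread.
    exact: lt.
  apply: antiU => //; apply: antiC => //; apply: antiU; first exact: jj.
  by apply: antiU; apply: antiC => //; [apply: jlane | apply: jthread].
- by move=> i j _; have [x xl ax] := jl i j; exists x => //; rewrite !in_setU xl orbT.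
- by move=> i j _; have [x xl ax] := jth i j; exists x => //; rewrite !in_setU xl !orbT.
- move=> i j k _ ki kj; apply: antiC => //; apply: antiU; first exact: jj.
  by apply: antiU; apply: antiC => //; [apply: jlane | apply: jthread].
by move=> i j k l _ _; apply: jj.
Qed.

End Route.

Lemma near_minor (H : sgraph) (F : aug -> {set H}) : symmetric same ->
  (forall x, econ (@adj H) (F x)) ->
  (forall x y, adjA x y -> linked (@adj H) (F x) (F y)) ->
  (forall x y, x != y -> ~~ meetA x y -> [disjoint F x & F y]) -> minor (complete t) H.
Proof.
move=> ss cF lF dF; have [g [gL gB gE]] := near_lanes.
exact: (near_minor_route gL gB gE ss cF lF dF).
Qed.

End Near.

(** * Links between distant rows *)

Section Far.
Variables (w m h t D : nat) (Ev : finType).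
Variables (src dst : Ev -> gridpoint w m h) (same : rel Ev).
Hypothesis m0 : 0 < m.
Local Notation aug := (augmented w m h Ev).
Local Notation adjA := (aug_adj src dst).
Local Notation meetA := (aug_meet src dst same).
Local Notation gp := (@aug_pt w m h Ev).
Hypotheses (t0 : 0 < t) (tw : 8 * t <= w) (tD : 8 * t + 8 <= D).
Variables (Z kr : nat -> bool -> nat) (lab : nat -> nat) (ev : nat -> Ev).
Local Notation q := (t * t).
Local Notation vx n := (inr (ev n) : aug).
Local Notation end_pt n b := (gp (rowX w m (kr n b) (lab n)) (2 * Z n b)).
Hypotheses
  (ZD : forall n n' b b', n < q -> n' < q -> (n, b) != (n', b') ->
     Z n b + D <= Z n' b' \/ Z n' b' + D <= Z n b)
  (Zh : forall n b, n < q -> Z n b <= h)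
  (kr3 : forall n b, n < q -> kr n b < 3)
  (labm : forall n, n < q -> 1 < lab n < m)
  (evE : forall n b, n < q -> adjA (end_pt n b) (vx n))
  (evP : forall n x, n < q -> adjA x (vx n) -> exists b, x = end_pt n b)
  (evS : forall n n', n < q -> n' < q -> n != n' ->
     ev n != ev n' /\ ~~ same (ev n) (ev n')).

(** Link [i * t + j] joins lane [i] to lane [t + j]. With the lanes [i] and [t + i] in bag [i], it
    connects the bags [i] and [j]. *)
Definition lane_of n (b : bool) := if b then t + n %% t else n %/ t.

Lemma lane_of_lt n b : n < q -> lane_of n b < 2 * t.
Proof.
move=> nq; rewrite /lane_of; have : n %% t < t by rewrite ltn_mod.
have : n %/ t < t by rewrite ltn_divLR.
by case: b; lia.
Qed.

(** The prescribed slope one makes the lane sweep over the end of the link. Two prescribed values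
    differ by less than [8 * t], which the distance [D >= 8 * t + 8] of the ends absorbs. *)
Lemma far_lanes : exists g, [/\ lipschitz g, forall y, g y <= w + 3 &
  forall n b, n < q -> g (Z n b).+1 = (g (Z n b)).+1 /\
    g (Z n b) + 4 * lane_of n b = w + kr n b].
Proof.
pose z (k : 'I_q * bool * bool) := Z k.1.1 k.1.2 + k.2.
pose b (k : 'I_q * bool * bool) := w + kr k.1.1 k.1.2 - 4 * lane_of k.1.1 k.1.2 + k.2.
have [||g [gL gz gB]] := @lipschitz_extension _ z b (w + 3).
- move=> [[n b1] b2] [[n' b1'] b2']; rewrite /b /z /=.
  have := kr3 b1 (ltn_ord n); have := kr3 b1' (ltn_ord n').
  have := lane_of_lt b1 (ltn_ord n); have := lane_of_lt b1' (ltn_ord n').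
  have hb : b2 <= 1 by case: b2.
  have hb' : b2' <= 1 by case: b2'.
  have [[e1 e2]|ne] := eqVneq (n : nat, b1) (n' : nat, b1').
    by rewrite e1 e2; lia.
  by have := ZD (ltn_ord n) (ltn_ord n') ne; lia.
- move=> [[n b1] b2]; rewrite /b /=; have := kr3 b1 (ltn_ord n).
  by case: b2; lia.
exists g; split=> // n b1 nq.
have := gz (Ordinal nq, b1, true); have := gz (Ordinal nq, b1, false).
rewrite /z /b /= addn0 !addn1 => -> ->.
by have := lane_of_lt b1 nq; lia.
Qed.

Lemma far_minor (H : sgraph) (F : aug -> {set H}) : symmetric same ->
  (forall x, econ (@adj H) (F x)) ->
  (forall x y, adjA x y -> linked (@adj H) (F x) (F y)) ->
  (forall x y, x != y -> ~~ meetA x y -> [disjoint F x & F y]) -> minor (complete t) H.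
Proof.
move=> ss cF lF dF; have [g [gL gB gE]] := far_lanes.
have symA := @aug_adj_sym w m h Ev src dst; have symM := aug_meetC src dst ss.
pose lane := @lane w m h Ev g.
have el n b : n < q -> end_pt n b \in lane (lane_of n b).
  move=> nq; have [g1 g2] := gE n b nq.
  by apply: lane_row => //; [apply: kr3 | apply: labm | apply: Zh].
have idx (i j : 'I_t) : i * t + j < q by apply: index_lt.
have lf (i j : 'I_t) : lane_of (i * t + j) false = i.
  by rewrite /lane_of divnMDl // divn_small ?addn0.
have lt (i j : 'I_t) : lane_of (i * t + j) true = t + j by rewrite /lane_of index_mod.
have elf (i j : 'I_t) : end_pt (i * t + j) false \in lane i.
  by have := el _ false (idx i j); rewrite lf.
have elt (i j : 'I_t) : end_pt (i * t + j) true \in lane (t + j).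
  by have := el _ true (idx i j); rewrite lt.
have ll c c' : c != c' -> anti meetA (lane c) (lane c') by apply: lane_lane.
have vl (c : nat) (i j : 'I_t) : c != i -> c != t + j ->
    anti meetA [set vx (i * t + j)] (lane c).
  move=> ci cj; apply: antiC => // x y xl; rewrite in_set1 => /eqP->.
  case: x xl => [p|e] pl; last by rewrite inE in pl.
  apply/andP; split=> //; apply/negP => /(evP (idx i j)) [b e].
  have pb := el _ b (idx i j); rewrite -e in pb.
  have cb : c != lane_of (i * t + j) b by case: b {e pb}; rewrite ?lf ?lt.
  by have /andP[/eqP] := ll _ _ cb _ _ pl pb.
have vv (i j k l : 'I_t) : i != k -> anti meetA [set vx (i * t + j)] [set vx (k * t + l)].
  move=> ik x y; rewrite !in_set1 => /eqP-> /eqP->.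
  have [|e1 e2] := evS (idx i j) (idx k l).
    by apply: contraNneq ik => e; apply/eqP/val_inj => /=; rewrite -(lf i j) -(lf k l) e.
  by apply/andP; split=> //; apply: contraNneq e1 => -[].
have vM (i j k : 'I_t) : k != i -> k != j ->
    anti meetA [set vx (i * t + j)] (lane k :|: lane (t + k)).
  move=> ki kj; apply: antiC => //; apply: antiU; apply: antiC => //; apply: vl => //.
  - by have := ltn_ord k; lia.
  - by have := ltn_ord i; lia.
  by rewrite eqn_add2l.
apply: (@minor_complete_regions H aug adjA meetA F cF lF dF t
  (fun i => vx (i * t + i) |: (lane i :|: lane (t + i))) (fun i j => vx (i * t + j))).
- move=> i; have cl c : c < 2 * t -> econ adjA (lane c).
    by move=> ct; apply: lane_econ => // y; have := gB y; lia.
  rewrite setUA; apply: econU => //; last first.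
  + exists (vx (i * t + i)), (end_pt (i * t + i) true).
    by rewrite in_setU1 eqxx elt symA evE ?orbT.
  + by apply: cl; have := ltn_ord i; lia.
  apply: econ_add => //; first by apply: cl; have := ltn_ord i; lia.
  exists (end_pt (i * t + i) false), (vx (i * t + i)).
  by rewrite in_set1 eqxx elf evE ?orbT.
- move=> i j ij; have ji : j != i by rewrite eq_sym.
  apply: antiU.
    by apply: antiC => //; apply: antiU; apply: antiC => //; [apply: vv | apply: vM].
  apply: antiC => //; apply: antiU; first exact: vM.
  have hi := ltn_ord i; have hj := ltn_ord j.
  by apply: antiU; apply: antiC => //; apply: antiU; apply: ll; move: ij ji; rewrite -!val_eqE /=; lia.
- move=> i j _; exists (end_pt (i * t + j) false); last exact: evE.
  by rewrite !in_setU elf ?orbT.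
- move=> i j _; exists (end_pt (i * t + j) true); last by rewrite symA evE.
  by rewrite !in_setU elt ?orbT.
- move=> i j k _ ki kj; apply: antiC => //; apply: antiU; first by apply: vv.
  by apply: antiC => //; apply: vM.
by move=> i j k l _ _; apply: vv.
Qed.

End Far.

(** * Minors from links *)

Section Linked.
Variables w m h P : nat.
Hypotheses (wm : 2 * w < m) (P0 : 0 < P).
Local Notation G := (canvas w m h P).
Variables (H : sgraph) (Rg : G -> subgraph H).
Hypotheses (cR : forall v, connected (Rg v))
  (RP : forall u v, u != v ->
     (adj u v <-> sub_vertices (Rg u) :&: sub_vertices (Rg v) != set0)).
Local Notation rho v := (sub_vertices (Rg v)).
Local Notation con := (econ (@adj H)).
Local Notation lnk := (linked (@adj H)).
Variables (N K : nat) (phi : 'I_N -> row h) (lab : 'I_K -> nat) (Wk : 'I_K -> 'I_N -> {set H}).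
Local Notation special_row := (special_row h P).
Hypotheses (NPh : N * P <= h) (labI : injective lab)
  (labP : forall k, [/\ 1 < lab k, lab k < m & ~~ odd (lab k)])
  (phiP : forall s, valid P (phi s) /\ phi s != special_row s)
  (WkP : forall k s, [/\ con (Wk k s), lnk (rho (label_pt w m P (special_row s) (lab k))) (Wk k s)
        & lnk (Wk k s) (rho (label_pt w m P (phi s) (lab k)))])
  (WkD : forall k s z, inl z != label_pt w m P (phi s) (lab k) ->
        [disjoint Wk k s & rho (inl z)])
  (WkI : forall k k' s s', k != k' -> [disjoint Wk k s & Wk k' s']).

Definition label_gp (r : row h) a : gridpoint w m h :=
  (inord (rowX w m r.1 a), inord (2 * r.2)).

Definition link : finType := ('I_K * 'I_N)%type.
Definition link_src (e : link) := label_gp (special_row e.2) (lab e.1).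
Definition link_dst (e : link) := label_gp (phi e.2) (lab e.1).
Definition same_column : rel link := fun e e' => e.1 == e'.1.
Local Notation aug := (augmented w m h link).
Local Notation adjA := (aug_adj link_src link_dst).
Local Notation meetA := (aug_meet link_src link_dst same_column).
Local Notation gp := (@aug_pt w m h link).

Definition region (x : aug) : {set H} :=
  match x with inl p => rho (inl p) | inr e => Wk e.1 e.2 end.

Lemma same_columnC : symmetric same_column.
Proof. by move=> e e'; rewrite /same_column eq_sym. Qed.

Lemma region_econ x : con (region x).
Proof. by case: x => [p|[k s]]; [apply: (region_con cR) | have [] := WkP k s]. Qed.

Lemma region_link x y : adjA x y -> lnk (region x) (region y).
Proof.
have symH := @adj_sym H.
have main p (e : link) : (p == link_src e) || (p == link_dst e) ->
    lnk (rho (inl p)) (Wk e.1 e.2).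
  by have [_ l1 l2] := WkP e.1 e.2; case/orP=> /eqP-> //; apply: linkedC.
case: x y => [p|e] [q|e'] //=; first by move=> a; apply: (region_linked RP).
  exact: main.
by move=> a; apply: linkedC => //; apply: main.
Qed.

Lemma region_meet x y : x != y -> ~~ meetA x y -> [disjoint region x & region y].
Proof.
have main p (e : link) : ~~ ((p == link_src e) || (p == link_dst e)) ->
    [disjoint Wk e.1 e.2 & rho (inl p)].
  rewrite negb_or => /andP[_ pd]; apply: WkD.
  by apply: contraNneq pd => -[->].
case: x y => [p|e] [q|e'] //= xy a.
- by apply: (region_disjoint RP).
- by rewrite disjoint_sym; apply: main.
- exact: main.
exact: WkI.
Qed.

Lemma special_height (s : 'I_N) : (special_row s).2 = s.+1 * P :> nat.
Proof. by rewrite special_row2 //; apply: leq_trans NPh; rewrite leq_mul2r ltn_ord orbT. Qed.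

Lemma gp_label (r : row h) k y a : r.1 = k :> nat -> r.2 = y :> nat ->
  gp (rowX w m k a) (2 * y) = inl (label_gp r a).
Proof. by move=> <- <-. Qed.

Lemma gp_special (s : 'I_N) a :
  gp (rowX w m 1 a) (2 * (s.+1 * P)) = inl (label_gp (special_row s) a).
Proof. by apply: gp_label; rewrite ?special_row1 ?special_height. Qed.

(* Links into a common row [f]: the star centred at [f] gives a complete
   bipartite graph between the special rows and the columns. *)
Lemma star_links t (f : row h) (S : 'I_t -> 'I_N) (kk : 'I_t -> 'I_K) :
  injective S -> injective kk -> (forall i, phi (S i) = f) -> minor (complete t) H.
Proof.
move=> SI kI Sf; have symM := aug_meetC link_src link_dst same_columnC.
have m0 : 0 < m by lia.
pose y (s : 'I_N) := s.+1 * P.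
have yh s : y s <= h by rewrite /y -special_height -ltnS ltn_ord.
pose L s : {set aug} := block w m h link
  (fun y' X => (y' == y s) && (grid_col w m w.+1 + 2 <= X <= grid_col w m w.+2 - 2)) id.
pose pf a : aug := inl (label_gp f a).
have pfE a k : 1 < a < m -> [set pf a] = block w m h link
    (fun y' X => (y' == f.2) && (X == rowX w m f.1 a)) k.
  move=> am; apply/setP=> -[[Z Y]|e]; last by rewrite !inE.
  rewrite !inE /pf -(gp_label a (erefl _) (erefl _)) gp_eq ?row_height //; last by apply: rowX_width; lia.
  by rewrite /=; have [o|o] := boolP (odd Y); lia.
have labm k : 1 < lab k < m by have [-> ->] := labP k.
have bL k : grid_col w m w.+1 + 2 <= rowX w m 1 (lab k) <= grid_col w m w.+2 - 2.
  have := @rowX_between w m m0 1 (lab k) isT (labm k); rewrite addn1 => -[]; lia.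
have srcL k (s : 'I_N) : inl (label_gp (special_row s) (lab k)) \in L s.
  rewrite -gp_special; apply: block_gp; [by apply: rowX_width; have := labm k; lia | exact: yh |].
  by rewrite eqxx bL.
have LL (s s' : 'I_N) : s != s' -> anti meetA (L s) (L s').
  move=> ss; apply: block_anti => z X X' /andP[/eqP-> _] /andP[/eqP e _].
  case/eqP: ss; apply: val_inj => /=; move/eqP: e; rewrite /y eqn_pmul2r //; by case/eqP.
have Lpf i k : anti meetA (L (S i)) [set pf (lab k)].
  rewrite (pfE _ id (labm k)); apply: block_anti => z X X' /andP[/eqP-> bX] /andP[/eqP e /eqP->].
  have [_] := phiP (S i); rewrite Sf => ne.
  (* A middle row at this height would be the special row itself, which [phiP] excludes. *)
  have f1 : f.1 != 1 :> nat.
    apply: contraNneq ne => f1; apply/eqP/row_eq; first by rewrite special_row1.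
    by rewrite special_height -e.
  have := @rowX_between w m m0 f.1 (lab k) (ltn_ord _) (labm k).
  case: (f.1 : nat) f1 (ltn_ord f.1) => [|[|[|//]]] // _ _; rewrite ?addn0 ?addn2 => -[]; lia.
have pfpf k k' : k != k' -> anti meetA [set pf (lab k)] [set pf (lab k')].
  move=> kk'; rewrite (pfE _ id (labm k)) (pfE _ id (labm k')).
  apply: block_anti => z X X' /andP[_ /eqP->] /andP[_ /eqP->].
  (* Distinct even labels differ by at least two, so the two points are not adjacent. *)
  have [a1 a2 a3] := labP k; have [b1 b2 b3] := labP k'.
  have ab : lab k <> lab k' by move/labI/eqP; apply/negP.
  by rewrite /rowX /colR /colL; repeat case: ifP => _; lia.
pose vx i j : aug := inr (kk i, S j).
have vL i j l : l != j -> anti meetA [set vx i j] (L (S l)).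
  move=> lj; apply: antiC => // x x' xL; rewrite in_set1 => /eqP->.
  case: x xL => [p|e] pL; last by rewrite inE in pL.
  apply/andP; split=> //; apply/negP => /= /orP[]/eqP e; rewrite e in pL.
    have ss : S l != S j by apply: contra_neq lj => /SI.
    by have /andP[/eqP] := LL _ _ ss _ _ pL (srcL (kk i) (S j)).
  have := Lpf l (kk i) _ _ pL (set11 _); rewrite /pf -(Sf j) /link_dst /= eqxx; by [].
have vpf i j l : l != i -> anti meetA [set vx i j] [set pf (lab (kk l))].
  move=> li; apply: antiC => // x x'; rewrite !in_set1 => /eqP-> /eqP->.
  apply/andP; split=> //; apply/negP => /= /orP[]/eqP e.
    have := Lpf j (kk l) _ _ (srcL (kk i) (S j)) (set11 _).
    by rewrite /pf e /link_src /= eqxx.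
  have ki : kk l != kk i by apply: contra_neq li => /kI.
  have := pfpf _ _ ki _ _ (set11 _) (set11 _).
  by rewrite /pf e /link_dst /= Sf eqxx.
have vv i j k l : i != k -> anti meetA [set vx i j] [set vx k l].
  move=> ik x x'; rewrite !in_set1 => /eqP-> /eqP->.
  have ki : kk i != kk k by apply: contra_neq ik => /kI.
  by apply/andP; split=> //; apply: contra_neq ik => -[/kI].
have vM i j k : k != i -> k != j ->
    anti meetA [set vx i j] (vx k k |: (pf (lab (kk k)) |: L (S k))).
  move=> ki kj; apply: antiC => //; apply: antiU.
    by apply: vv.
  by apply: antiU; apply: antiC => //; [apply: vpf | apply: vL].
have adjs i j : adjA (inl (label_gp (special_row (S j)) (lab (kk i)))) (vx i j).
  by rewrite /= eqxx.
have adjd i j : adjA (vx i j) (pf (lab (kk i))) by rewrite /= /link_dst /= Sf eqxx orbT.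
apply: (@minor_complete_regions H aug adjA meetA region region_econ region_link region_meet t
  (fun i => vx i i |: (pf (lab (kk i)) |: L (S i))) vx).
- move=> i; rewrite setUCA; apply: econ_add.
  + exact: aug_adj_sym.
  + apply: econ_add; first exact: aug_adj_sym.
      by apply: econ_row => //; [have := bL (kk i); lia |
        have : grid_col w m w.+2 < width w m by [apply: col_width => //; lia]; lia].
    exists (inl (label_gp (special_row (S i)) (lab (kk i)))), (vx i i).
    by rewrite in_set1 eqxx srcL adjs orbT.
  by exists (vx i i), (pf (lab (kk i))); rewrite in_set1 in_setU1 !eqxx adjd orbT.
- move=> i j ij; have ji : j != i by rewrite eq_sym.
  apply: antiU; first by apply: vM.
  apply: antiU; apply: antiC => //; apply: antiU.
  + exact: vpf.
  + apply: antiU; last exact: Lpf.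
    by apply: pfpf; apply: contra_neq ji => /kI.
  + exact: vL.
  apply: antiU; first by apply: antiC => //; apply: Lpf.
  by apply: LL; apply: contra_neq ji => /SI.
- by move=> i j _; exists (pf (lab (kk i))); rewrite ?in_setU ?in_set1 ?eqxx ?orbT // aug_adj_sym.
- move=> i j _; exists (inl (label_gp (special_row (S j)) (lab (kk i)))); last by rewrite aug_adj_sym.
  by rewrite !in_setU srcL !orbT.
- by move=> i j k _ ki kj; apply: vM.
by move=> i j k l _ _; apply: vv.
Qed.

Section Crossings.
Variables (t D : nat).
Hypotheses (t0 : 0 < t) (tw : 8 * t <= w) (tD : 8 * t + 8 <= D) (DP : 4 * D <= P)
  (NPD : N * P + D <= h).
Variables (S : nat -> 'I_N) (kk : nat -> 'I_K).
Hypothesis kkE : forall n, n < t * t -> kk n = n :> nat.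

(** Each index uses a label of its own, so its link lies in a region of its own. *)
Lemma links_distinct n n' : n < t * t -> n' < t * t -> n != n' ->
  (kk n, S n) != (kk n', S n') /\ ~~ same_column (kk n, S n) (kk n', S n').
Proof.
move=> nq nq' nn; have ne : kk n != kk n' by rewrite -val_eqE /= !kkE.
by split=> //; apply: contraNneq ne => -[->].
Qed.

Lemma near_links : (forall n n', n < n' < t * t -> S n < S n') ->
  (forall n, n < t * t -> [/\ (phi (S n)).1 != 1 :> nat,
     (phi (S n)).2 < (S n).+1 * P + D & (S n).+1 * P < (phi (S n)).2 + D]) ->
  minor (complete t) H.
Proof.
(* A link to the right part jumps over [colR], and one to the left part jumps over [colL]. *)
move=> Sinc nr; pose up n := (phi (S n)).1 == 2 :> nat.
pose Y n := (S n).+1 * P.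
pose yl n := if up n then Y n else (phi (S n)).2 : nat.
pose yr n := if up n then (phi (S n)).2 : nat else Y n.
pose kr n := if up n then 2 else 1.
have kind n : n < t * t -> ~~ up n -> (phi (S n)).1 = 0 :> nat.
  by move=> nq; have [k1 _ _] := nr n nq; move: k1; rewrite /up; have := ltn_ord (phi (S n)).1; lia.
apply: (@near_minor w m h t D P link link_src link_dst same_column _ t0 tw tD DP Y yl yr kr
  (fun n => lab (kk n)) (fun n => (kk n, S n)) _ _ _ _ _ _ _ _ _ _ H region same_columnC
  region_econ region_link region_meet).
- by lia.
- move=> n n' nn; have := Sinc n n' nn; rewrite /Y => ss.
  have : (S n).+2 * P <= (S n').+1 * P by rewrite leq_mul2r ltnS ss orbT.
  by rewrite (mulSn (S n).+1); lia.
- move=> n nq; have : (S n).+1 * P <= N * P by rewrite leq_mul2r ltn_ord orbT.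
  by rewrite /Y; split; [rewrite mulSn|]; lia.
- by move=> n nq; have [_ h1 h2] := nr n nq; rewrite /yl; case: ifP => _; rewrite -/(Y n) in h1 h2; lia.
- by move=> n nq; have [_ h1 h2] := nr n nq; rewrite /yr; case: ifP => _; rewrite -/(Y n) in h1 h2; lia.
- by move=> n _; rewrite /kr; case: ifP.
- by move=> n _; have [-> -> _] := labP (kk n).
- move=> n nq; rewrite /kr /yl; case: ifP => u.
    by rewrite gp_special /= eqxx.
  by rewrite (gp_label _ (kind n nq (negbT u)) (erefl _)) /= eqxx orbT.
- move=> n nq; rewrite /kr /yr; case: ifP => u.
    by rewrite (gp_label _ (eqP u) (erefl _)) /= eqxx orbT.
  by rewrite gp_special /= eqxx.
- move=> n [p|//] nq /=; rewrite /kr /yl /yr; case: ifP => u.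
    rewrite gp_special (gp_label _ (eqP u) (erefl _)).
    by case/orP=> /eqP->; [left | right].
  rewrite gp_special (gp_label _ (kind n nq (negbT u)) (erefl _)).
  by case/orP=> /eqP->; [right | left].
exact: links_distinct.
Qed.

Definition link_row (b : bool) s := if b then phi s else special_row s.

Lemma far_links :
  (forall n n' b b', n < t * t -> n' < t * t -> (n, b) != (n', b') ->
     let y := (link_row b (S n)).2 : nat in let y' := (link_row b' (S n')).2 : nat in
     y + D <= y' \/ y' + D <= y) ->
  minor (complete t) H.
Proof.
move=> sep.
apply: (@far_minor w m h t D link link_src link_dst same_column _ t0 tw tD
  (fun n b => (link_row b (S n)).2) (fun n b => (link_row b (S n)).1)
  (fun n => lab (kk n)) (fun n => (kk n, S n)) sep _ _ _ _ _ _ H region same_columnC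
  region_econ region_link region_meet).
- by lia.
- by move=> n b _; rewrite -ltnS ltn_ord.
- by move=> n b _; apply: ltn_ord.
- by move=> n _; have [-> -> _] := labP (kk n).
- by move=> n b _; rewrite (gp_label _ (erefl _) (erefl _)); case: b; rewrite /= eqxx ?orbT.
- by move=> n [p|//] _ /= /orP[]/eqP->; [exists false | exists true]; rewrite (gp_label _ (erefl _) (erefl _)).
exact: links_distinct.
Qed.

End Crossings.

End Linked.

(** * Choosing the links *)

Lemma increasing_in N (A : {set 'I_N}) q : q <= #|A| ->
  exists2 f : 'I_q -> 'I_N, forall i, f i \in A & forall i j : 'I_q, i < j -> f i < f j.
Proof.
move=> qA; exists (fun i => enum_val (widen_ord qA i)) => [i|i j ij]; first exact: enum_valP.
have srt : sorted (fun a b : 'I_N => a < b) (enum A).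
  rewrite {1}/enum_mem -enumT; apply: sorted_filter; first by move=> ? ? ?; apply: ltn_trans.
  by have := iota_ltn_sorted 0 N; rewrite -val_enum_ord sorted_map.
have x0 := enum_val (widen_ord qA i).
rewrite !(enum_val_nth x0); apply: (sorted_ltn_nth _ _ srt) => //.
- by move=> ? ? ?; apply: ltn_trans.
- by rewrite inE -cardE (leq_trans (ltn_ord i)).
by rewrite inE -cardE (leq_trans (ltn_ord j)).
Qed.

(** A greedy independent set: each chosen element discards itself and at most [d] others. *)
Lemma greedy_choice (T : finType) (c : rel T) d q (A : {set T}) :
  (forall x, x \in A -> #|[set y | c x y]| <= d) -> q * d.+1 <= #|A| ->
  exists s, [/\ size s = q, {subset s <= A} & pairwise (fun x y => (x != y) && ~~ c x y) s].
Proof.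
elim: q A => [|q IH] A dA qA; first by exists [::].
have /card_gt0P[x xA] : 0 < #|A| by move: qA; rewrite mulSn; lia.
pose B := A :\: (x |: [set y | c x y]).
have sBA : B \subset A by apply: subsetDl.
have [||s [sz sB ps]] := IH B.
- by move=> y yB; apply: dA; apply: (subsetP sBA).
- have := dA x xA; have := cardsD A (x |: [set y | c x y]); rewrite -/B.
  have : #|A :&: (x |: [set y | c x y])| <= #|x |: [set y | c x y]|.
    by apply/subset_leq_card/subsetIr.
  have : #|x |: [set y | c x y]| <= 1 + #|[set y | c x y]|.
    by rewrite cardsU1; case: (x \notin _).
  by move: qA; rewrite mulSn; lia.
exists (x :: s); split=> /=; first by rewrite sz.
  by move=> y; rewrite inE => /orP[/eqP->//|/sB/(subsetP sBA)].
rewrite ps andbT; apply/allP => y /sB; rewrite !inE negb_or => /andP[/andP[yx cy] _].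
by rewrite eq_sym yx.
Qed.

Section Selection.
Variables (N h P D : nat) (phi : 'I_N -> row h).
Hypotheses (D0 : 0 < D) (DP : D <= P) (NPh : N * P <= h).
Local Notation special_row := (special_row h P).
Local Notation link_row := (link_row P phi).

Definition close y y' := (y < y' + D) && (y' < y + D).

Lemma special_rowI : injective (fun s : 'I_N => special_row s).
Proof.
move=> s s' e; apply: val_inj => /=.
have : (special_row s).2 = (special_row s').2 :> nat by rewrite e.
rewrite !(special_height NPh) => /eqP.
by rewrite eqn_pmul2r; [case/eqP | lia].
Qed.

Definition near s := ((phi s).1 != 1 :> nat) && close (s.+1 * P) (phi s).2.

Definition conflict : rel 'I_N := fun s s' =>
  [exists b, [exists b', close (link_row b s).2 (link_row b' s').2]].

(** If the partner row lies in the middle, it is another special row and hence at distance at least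
    [P >= D]; otherwise distance is what [near] denies. *)
Lemma far_self s b b' : valid P (phi s) -> phi s != special_row s -> ~~ near s -> b != b' ->
  ~~ close (link_row b s).2 (link_row b' s).2.
Proof.
move=> v ne nr; wlog : b b' / b = false.
  move=> hw; case: b b' => [] [] // _; last by apply: hw.
  have := hw false true (erefl _) isT; by rewrite /close andbC.
move=> -> {b}; case: b' => // _ /=; rewrite (special_height NPh).
have [k1|k1] := eqVneq ((phi s).1 : nat) 1; last first.
  by move: nr; rewrite /near k1.
move: v; rewrite /valid k1 eqxx => /dvdnP[z e].
have zs : z <> s.+1.
  move=> zs; case/eqP: ne; apply: row_eq; first by rewrite special_row1.
  by rewrite (special_height NPh) e zs.
rewrite /close e; have [lt|lt|//] := ltngtP z s.+1.
  have : z.+1 * P <= s.+1 * P by rewrite leq_mul2r lt orbT.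
  by rewrite mulSn; lia.
have : s.+2 * P <= z * P by rewrite leq_mul2r lt orbT.
by rewrite (mulSn s.+1); lia.
Qed.

Variable t : nat.
Hypotheses (t0 : 0 < t) (fib : forall f, #|[set s | phi s == f]| < t).

(** A row with height close to [y] is determined by its part and one of [2 * D] offsets, and [fib]
    leaves fewer than [t] links into any one row. *)
Lemma card_close y b : #|[set s | close y (link_row b s).2]| <= t * (3 * (2 * D)).
Proof.
have -> : 3 * (2 * D) = #|{: 'I_3 * 'I_(2 * D)}| by rewrite card_prod !card_ord.
have D2 : 0 < 2 * D by lia.
pose off (s : 'I_N) : 'I_(2 * D) := insubd (Ordinal D2) ((link_row b s).2 + D - y).
apply: (@card_fibers _ _ _ (fun s => ((link_row b s).1, off s))) => rz.
have offE s : close y (link_row b s).2 -> off s = (link_row b s).2 + D - y :> nat.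
  by move=> c; rewrite /off val_insubd; move: c; rewrite /close => c; case: ifP; lia.
pose X := [set s in [set s | close y (link_row b s).2] | ((link_row b s).1, off s) == rz].
rewrite -/X.
have [->|[s0 s0X]] := set_0Vmem X; first by rewrite cards0.
have [c0 e0] : close y (link_row b s0).2 /\ ((link_row b s0).1, off s0) = rz.
  by move: s0X; rewrite !inE => /andP[-> /eqP].
have sub : X \subset [set s | link_row b s == link_row b s0].
  apply/subsetP=> s; rewrite !inE -e0 => /andP[c /eqP[e1 e2]].
  apply/eqP/row_eq; first by rewrite e1.
  have := offE s c; have := offE s0 c0; rewrite e2 => -> .
  by move: c c0; rewrite /close; lia.
apply: leq_trans (subset_leq_card sub) _.
case: (b) => /=; first exact/ltnW/fib.
rewrite (_ : [set s | _] = [set s0]) ?cards1 //.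
by apply/setP=> s; rewrite !inE (inj_eq special_rowI).
Qed.

Lemma card_conflict s : #|[set s' | conflict s s']| <= 4 * (t * (3 * (2 * D))).
Proof.
pose C b b' := [set s' | close (link_row b s).2 (link_row b' s').2].
have sub : [set s' | conflict s s'] \subset
    (C true true :|: C true false) :|: (C false true :|: C false false).
  apply/subsetP=> s'; rewrite !inE => /existsP[b /existsP[b' c]].
  by case: b b' c => [] [] ->; rewrite ?orbT.
apply: leq_trans (subset_leq_card sub) _.
have := card_close (link_row true s).2 true; have := card_close (link_row true s).2 false.
have := card_close (link_row false s).2 true; have := card_close (link_row false s).2 false.
rewrite -/(C true true) -/(C true false) -/(C false true) -/(C false false).
have := (leq_card_setU (C true true :|: C true false) (C false true :|: C false false)).1.
have := (leq_card_setU (C true true) (C true false)).1.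
have := (leq_card_setU (C false true) (C false false)).1.
by lia.
Qed.

End Selection.

(** * Choice of the parameters and conclusion *)

Lemma canvas_not_region t : 0 < t -> exists w m h P, 2 * w < m /\
  forall H : sgraph, region_intersection_graph (canvas w m h P) H -> minor (complete t) H.
Proof.
(* The bundles have room for [2 * t] lanes with spacing four. [N] guarantees [q] near links or
   [q * d.+1] others, from which the greedy choice keeps [q]. The summand [D] in [h] is room above
   the last special row, and [J] makes [q] labels share one map. *)
move=> t0; pose D := 8 * t + 8; pose P := 4 * D; pose w := 8 * t; pose q := t * t.
pose d := 4 * (t * (3 * (2 * D))); pose N := q + q * d.+1; pose h := N * P + D.
pose J := (q * #|{ffun 'I_N -> row h}|).+1; pose m := 2 * J + 2 * w + 1.
exists w, m, h, P; split; first by rewrite /m; lia.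
move=> H [Rg [cR RP]].
have wm : 2 * w < m by rewrite /m; lia.
have P0 : 0 < P by rewrite /P /D; lia.
have D0 : 0 < D by rewrite /D; lia.
have DP : D <= P by rewrite /P; lia.
have DP4 : 4 * D <= P by [].
have NPD : N * P + D <= h by [].
have NPh : N * P <= h by rewrite /h leq_addr.
have tw : 8 * t <= w by []. have tD : 8 * t + 8 <= D by [].
have KJ : q * #|{ffun 'I_N -> row h}| < J by [].
have Jm : 2 * J < m by rewrite /m -addnA addn1 addnS ltnS leq_addr.
have q0 : 0 < q by rewrite muln_gt0 t0.
have [phi [lab [Wk [[labI labP] phiP WkP WkD WkI]]]] := links wm P0 cR RP NPh KJ Jm.
pose kk n : 'I_q := insubd (Ordinal q0) n.
have kkE n : n < q -> kk n = n :> nat by move=> nq; rewrite /kk val_insubd nq.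
case: (pickP [pred f | t <= #|[set s | phi s == f]|]) => [f /= tf|nostar].
  have [S SI SP] := injection_of_card tf.
  have tq : t <= q by rewrite leq_pmulr.
  apply: (star_links wm P0 cR RP NPh labI labP phiP WkP WkD WkI
    (f := f) (kk := widen_ord tq) SI).
    by move=> i j [/val_inj].
  by move=> i; have := SP i; rewrite inE => /eqP.
have fib f : #|[set s | phi s == f]| < t by rewrite ltnNge; have /= -> := nostar f.
pose Near := [set s | near P D phi s].
have [nq|nq] := leqP q #|Near|.
  have [f fN fI] := increasing_in nq.
  apply: (near_links wm P0 cR RP NPh labP WkP WkD WkI
    t0 tw tD DP4 NPD (S := fun n => f (kk n)) kkE).
    move=> n n' /andP[nn nq']; apply: fI; rewrite !kkE //; exact: ltn_trans nq'.
  move=> n _; have := fN (kk n); rewrite inE /near /close => /and3P[k c1 c2].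
  by split=> //.
have [||s [sz sA ps]] := @greedy_choice _ (conflict P D phi) d q (~: Near).
- by move=> s _; apply: card_conflict.
- have := cardsC Near; rewrite card_ord; move: nq; rewrite -/N /N; lia.
have s0 : 0 < size s by rewrite sz.
pose x0 := nth (Ordinal (leq_trans q0 (leq_addr _ _)) : 'I_N) s 0.
pose S n := nth x0 s n.
have SN n : n < q -> ~~ near P D phi (S n).
  by move=> nq'; have := sA (S n); rewrite mem_nth ?sz // !inE => /(_ isT).
have SS n n' : n < n' < q -> ~~ conflict P D phi (S n) (S n').
  move=> /andP[nn nq']; have /pairwiseP/(_ n n') := ps.
  by rewrite !inE sz (ltn_trans nn nq') nq' => /(_ x0 isT isT nn) /andP[].
apply: (far_links wm P0 cR RP NPh labP WkP WkD WkI
    t0 tw tD DP4 NPD (S := S) kkE).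
move=> n n' b b' nq1 nq2 ne y y'.
suff : ~~ close D (link_row P phi b (S n)).2 (link_row P phi b' (S n')).2.
  by rewrite /close negb_and -!leqNgt => /orP[]; [right | left].
have [e|e|e] := ltngtP n n'.
- by have := SS n n'; rewrite e nq2 => /(_ isT) /existsPn/(_ b)/existsPn/(_ b').
- have := SS n' n; rewrite e nq1 => /(_ isT) /existsPn/(_ b')/existsPn/(_ b).
  by rewrite /close andbC.
rewrite -e; have [v ns] := phiP (S n); apply: (far_self D0 DP NPh v ns (SN n nq1)).
by apply: contraNneq ne => ->; rewrite e.
Qed.

Theorem theorem3p1 (t : nat) (ht : 0 < t) :
  exists G : sgraph,
    [/\ has_girth G 5,
        ~ induced_minor (subdiv (complete 6)) G
      & ~ exists H : sgraph,
            minor_free (complete t) H /\ region_intersection_graph G H].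
Proof.
have [w [m [h [P [wm rig]]]]] := canvas_not_region ht.
exists (canvas w m h P); split; first exact: canvas_girth.
  exact: canvas_K6_free.
by move=> [H [nH /rig]].
Qed.
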